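(* Each of the binary matroids $\mathrm{PG}(3,2)\backslash e$, $L_{19}$, and $L_{11}$ is an excluded minor for the class of even-cycle matroids; that is, none of them is an even-cycle matroid, but every proper minor of each of them is.
   Context: Even-cycle matroid: a binary matroid $M\binom{w}{D}$ (vector matroid of the matrix obtained by placing the row $w$ above $D$) where $D$ is the vertex-edge incidence matrix over $\mathrm{GF}(2)$ of a graph $G=(V,E)$ and $w\in\mathrm{GF}(2)^E$ is the characteristic vector of a set $W\subseteq E$. $\mathrm{PG}(3,2)\backslash e$ is $\mathrm{PG}(3,2)$ with one element deleted. $L_{19}$ is the dual of the cycle matroid of the graph obtained from $K_7$ by deleting two adjacent edges. $L_{11}$ is the vector matroid over $\mathrm{GF}(2)$ of the matrix with rows $10000010101$, $01000010011$, $00100001110$, $00010001101$, $00001001011$, $00000100111$. *)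

(* Defs.v *)
From HB Require Import structures.
From mathcomp Require Import all_boot all_order all_algebra.

Set Implicit Arguments.
Unset Strict Implicit.
Unset Printing Implicit Defensive.

Import GRing.Theory.
Local Open Scope ring_scope.

(** * Matroids *)

Definition matroid_axiom (E : finType) (I : {set {set E}}) : bool :=
  [&& set0 \in I,
      [forall A in I, forall B : {set E}, (B \subset A) ==> (B \in I)]
    & [forall A in I, forall B in I,
         (#|A| < #|B|)%N ==> [exists x in B :\: A, x |: A \in I]]].

Record matroid (E : finType) : Type := Matroid {
  indep : {set {set E}};
  indepP : matroid_axiom indep
}.

(* The axioms are boolean, so matroids with the same independent sets are
   equal for [=]. *)
Lemma matroid_eq (E : finType) (M N : matroid E) : indep M = indep N -> M = N.
Proof.
case: M N => [I PI] [J PJ] /= eIJ; rewrite -{J}eIJ in PJ *.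
by rewrite (bool_irrelevance PI PJ).
Qed.

Lemma matroid_axiomP (E : finType) (I : {set {set E}}) :
  reflect [/\ set0 \in I,
              forall A B : {set E}, A \in I -> B \subset A -> B \in I
            & forall A B : {set E}, A \in I -> B \in I -> (#|A| < #|B|)%N ->
                exists2 x, x \in B :\: A & x |: A \in I]
          (matroid_axiom I).
Proof.
apply: (iffP and3P) => -[I0 IS IA]; split => //.
- move=> A B AI BA.
  by have /forall_inP/(_ _ AI)/forallP/(_ B)/implyP := IS; apply.
- move=> A B AI BI ltAB; apply/exists_inP.
  by have /forall_inP/(_ _ AI)/forall_inP/(_ _ BI)/implyP := IA; apply.
- apply/forall_inP => A AI; apply/forallP => B; apply/implyP.
  exact: IS.
- apply/forall_inP => A AI; apply/forall_inP => B BI; apply/implyP => ltAB.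
  by apply/exists_inP; apply: IA.
Qed.

Section MatroidTheory.
Variables (E : finType) (M : matroid E).
Implicit Types A B C : {set E}.

Lemma indep0 : set0 \in indep M.
Proof. by case/matroid_axiomP: (indepP M). Qed.

Lemma indepS A B : A \in indep M -> B \subset A -> B \in indep M.
Proof. by case/matroid_axiomP: (indepP M) => _ h _; apply: h. Qed.

Lemma indep_aug A B : A \in indep M -> B \in indep M -> (#|A| < #|B|)%N ->
  exists2 x, x \in B :\: A & x |: A \in indep M.
Proof. by case/matroid_axiomP: (indepP M) => _ _ h; apply: h. Qed.

Definition basis (B : {set E}) : bool := maxset (fun A => A \in indep M) B.

Lemma basis_indep B : basis B -> B \in indep M.
Proof. by case/maxsetP. Qed.

Lemma basis_ge B A : basis B -> A \in indep M -> (#|A| <= #|B|)%N.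
Proof.
move=> /maxsetP[BI Bmax] AI; rewrite leqNgt; apply/negP => ltBA.
have [x /setDP[_ xB] xBI] := indep_aug BI AI ltBA.
have eB := Bmax _ xBI (subsetUr _ _).
by move: xB; rewrite -eB setU11.
Qed.

Lemma basisE B A : basis B -> A \in indep M -> #|A| = #|B| -> basis A.
Proof.
move=> bB AI eAB; apply/maxsetP; split=> // C CI sAC.
apply/eqP; rewrite eq_sym eqEcard sAC /= eAB.
exact: basis_ge bB CI.
Qed.

Lemma indep_ext A B : A \in indep M -> B \in indep M -> (#|A| <= #|B|)%N ->
  exists C, [/\ C \in indep M, A \subset C, C \subset A :|: B & #|C| = #|B|].
Proof.
move=> AI BI; move: {2}(_ - _)%N (erefl (#|B| - #|A|)%N) => n.
elim: n A AI => [|n IHn] A AI.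
  move/eqP; rewrite subn_eq0 => leBA leAB.
  exists A; split=> //; first exact: subsetUl.
  by apply/eqP; rewrite eqn_leq leAB.
move=> eAB leAB; have ltAB : (#|A| < #|B|)%N by rewrite -subn_gt0 eAB.
have [x /setDP[xB xA] xAI] := indep_aug AI BI ltAB.
have cxA : #|x |: A| = #|A|.+1 by rewrite cardsU1 xA.
have [||C [CI sC1 sC2 cC]] := IHn _ xAI; rewrite ?cxA //.
  by rewrite subnS eAB.
exists C; split=> //; first exact: subset_trans (subsetUr _ _) sC1.
apply: subset_trans sC2 _; rewrite !subUset subsetUl subsetUr !andbT.
by rewrite sub1set inE xB orbT.
Qed.

Lemma basis_ex : exists B, basis B.
Proof.
have [B bB _] := @maxset_exists _ (fun A => A \in indep M) set0 indep0.
by exists B.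
Qed.

End MatroidTheory.

(* A set is independent in the dual iff it lies in the complement of a basis. *)
Definition dual_indep (E : finType) (M : matroid E) : {set {set E}} :=
  [set A : {set E} | [exists B : {set E}, basis M B && (A \subset ~: B)]].

Lemma dual_axiom (E : finType) (M : matroid E) : matroid_axiom (dual_indep M).
Proof.
apply/matroid_axiomP; split.
- have [B bB] := basis_ex M.
  by rewrite inE; apply/existsP; exists B; rewrite bB sub0set.
- move=> A B; rewrite !inE => /existsP[X /andP[bX sX]] sBA.
  by apply/existsP; exists X; rewrite bX (subset_trans sBA).
move=> A A'; rewrite !inE => /existsP[B /andP[bB dAB]].
move=> /existsP[B' /andP[bB' dAB']] ltA.
have B'AI : B' :\: A \in indep M.
  exact: indepS (basis_indep bB') (subsetDl _ _).
have [C [CI sBC sCB cC]] :=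
  indep_ext B'AI (basis_indep bB) (basis_ge bB B'AI).
have bC : basis M C by exact: basisE bB CI cC.
have dAC : A \subset ~: C.
  rewrite subsetC; apply: subset_trans sCB _.
  by rewrite subUset [B \subset _]subsetC dAB andbT setDE subsetIr.
have [sA'C | /subsetPn[x xA' xC]] := boolP (A' :\: A \subset C); last first.
  exists x => //; rewrite inE; apply/existsP; exists C; rewrite bC subUset dAC.
  by rewrite sub1set inE xC.
have dis : [disjoint B' :\: A & A' :\: A].
  rewrite -setI_eq0; apply/eqP/setP => x; rewrite !inE.
  case xA' : (x \in A'); rewrite ?andbF //.
  by move/subsetP/(_ _ xA'): dAB'; rewrite inE => /negbTE ->; rewrite !andbF.
have : (#|B' :\: A| + #|A' :\: A| <= #|C|)%N.
  rewrite -leq_card_setU in dis; move/eqP: dis => <-.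
  by apply: subset_leq_card; rewrite subUset sBC.
have: (#|A :&: B'| <= #|A :\: A'|)%N.
  apply/subset_leq_card/subsetP => x; rewrite !inE => /andP[-> xB'].
  rewrite andbT; apply/negP => xA'.
  by move/subsetP/(_ _ xA'): dAB'; rewrite inE xB'.
have := basis_ge bC (basis_indep bB'); have := basis_ge bB' (basis_indep bC).
move: ltA; rewrite -(cardsID A' A) -(cardsID A A') -[#|B'|](cardsID A B').
rewrite (setIC A' A) (setIC B' A) ltn_add2l => h1 h2 h3 h4 h5.
have := leq_trans h5 h2; rewrite addnC leq_add2r => h6.
by have := leq_trans (leq_trans h1 h6) h4; rewrite ltnn.
Qed.

Definition dual (E : finType) (M : matroid E) : matroid E :=
  Matroid (dual_axiom M).

Definition delete_indep (E : finType) (M : matroid E) (D : {set E}) :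
    {set {set {x : E | x \notin D}}} :=
  [set A : {set {x : E | x \notin D}} | val @: A \in indep M].

Lemma delete_axiom (E : finType) (M : matroid E) (D : {set E}) :
  matroid_axiom (delete_indep M D).
Proof.
apply/matroid_axiomP; split.
- by rewrite inE imset0 indep0.
- by move=> A B; rewrite !inE => AI sBA; apply: indepS AI _; apply: imsetS.
move=> A B; rewrite !inE => AI BI ltAB.
have [|x /setDP[/imsetP[y yB ->] yA] yAI] := indep_aug AI BI.
  by rewrite !card_imset //; apply: val_inj.
exists y; first by rewrite inE yB andbT; apply: contra yA; apply: imset_f.
by rewrite inE imsetU1.
Qed.

Definition delete (E : finType) (M : matroid E) (D : {set E}) :
    matroid {x : E | x \notin D} := Matroid (delete_axiom M D).

Definition contract (E : finType) (M : matroid E) (C : {set E}) :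
    matroid {x : E | x \notin C} := dual (delete (dual M) C).

Definition matroid_class : Type := forall E : finType, matroid E -> Prop.

(* Every minor of [M] is [M / C \ D] with [C] and [D] disjoint, that is, with
   [D] a set of elements of [M / C]; it is proper iff [C] and [D] are not both
   empty. *)
Definition excluded_minor (P : matroid_class) (E : finType) (M : matroid E) :
    Prop :=
  ~ P E M /\
  forall (C : {set E}) (D : {set {x : E | x \notin C}}),
    C != set0 \/ D != set0 -> P _ (delete (contract M C) D).

(** * Vector matroids *)

(* A matrix with rows indexed by [R] and columns by [E]; ['M_(m, n)] coerces
   to this with [R = 'I_m] and [E = 'I_n]. *)
Definition column (F : fieldType) (R E : finType) (A : R -> E -> F) (e : E) :
    {ffun R -> F^o} := [ffun r => A r e].

Definition vector_indep (F : fieldType) (R E : finType) (A : R -> E -> F) :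
    {set {set E}} :=
  [set X : {set E} | free [seq column A e | e in X]].

Section VectorMatroid.
Variables (F : fieldType) (R E : finType) (A : R -> E -> F).

Lemma perm_image_setU1 (T : eqType) (f : E -> T) (x : E) (X : {set E}) :
  x \notin X ->
  perm_eq [seq f e | e in x |: X] (f x :: [seq f e | e in X]).
Proof.
move=> xX; rewrite -(map_cons f); apply: perm_map; apply: uniq_perm.
- exact: enum_uniq.
- by rewrite /= enum_uniq mem_enum xX.
- by move=> y; rewrite inE !mem_enum !inE.
Qed.

Lemma vector_axiom : matroid_axiom (vector_indep A).
Proof.
apply/matroid_axiomP; split.
- by rewrite inE /image_mem enum_set0 nil_free.
- move=> X Y; rewrite !inE => fX sYX.
  have pXY : perm_eq (enum X) (enum Y ++ enum (X :\: Y)).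
    apply: uniq_perm; rewrite ?cat_uniq ?enum_uniq ?andbT //=.
      by apply/hasPn => y; rewrite !mem_enum inE => /andP[].
    move=> y; rewrite mem_cat !mem_enum !inE.
    by case yY: (y \in Y) => //=; rewrite (subsetP sYX).
  move: fX; rewrite (perm_free (perm_map (column A) pXY)) map_cat.
  exact: catl_free.
move=> X Y; rewrite !inE => fX fY ltXY.
have [//|nex] := boolP [exists x in Y :\: X, x |: X \in vector_indep A].
  by move/exists_inP.
suff : (#|Y| <= #|X|)%N by rewrite leqNgt ltXY.
have sYX : (<<[seq column A e | e in Y]>> <= <<[seq column A e | e in X]>>)%VS.
  apply/span_subvP => _ /imageP[x xY ->].
  have [xX | xX] := boolP (x \in X); first by rewrite memv_span ?image_f.
  apply: contraNT nex => nx; apply/exists_inP; exists x.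
    by rewrite inE xX.
  by rewrite inE (perm_free (perm_image_setU1 _ xX)) free_cons nx.
by have := dimvS sYX; rewrite (eqP fX) (eqP fY) !size_image.
Qed.
End VectorMatroid.

Definition vector_matroid (F : fieldType) (R E : finType) (A : R -> E -> F) :
    matroid E := Matroid (vector_axiom A).

(* The matrix obtained by placing the row [w] above [A]. *)
Definition add_row (F : fieldType) (R E : finType) (w : E -> F)
    (A : R -> E -> F) : option R -> E -> F :=
  fun r e => if r is Some r' then A r' e else w e.

(** * Graphs *)

(* Loops (a single end) and parallel edges are allowed. *)
Record graph (V E : finType) : Type := Graph {
  ends : E -> {set V};
  endsP : forall e, (0 < #|ends e| <= 2)%N
}.

(* The column of a loop is zero. *)
Definition incidence (V E : finType) (G : graph V E) (v : V) (e : E) : 'F_2 :=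
  ((#|ends G e| == 2%N) && (v \in ends G e))%:R.

(* [C] is the edge set of a cycle: there are distinct vertices v_0, ..., v_k and
   an enumeration e_0, ..., e_k of [C] such that e_i has ends v_i and v_(i+1),
   indices being read cyclically. This covers loops (k = 0) and pairs of
   parallel edges (k = 1). *)
Definition is_cycle (V E : finType) (G : graph V E) (C : {set E}) : bool :=
  (C != set0) &&
  [exists vs : #|C|.-tuple V, exists es : #|C|.-tuple E,
    [&& uniq vs, [set:: es] == C
      & [seq ends G e | e <- es]
          == [seq [set p.1; p.2] | p <- zip vs (rot 1 vs)]]].

Definition forests (V E : finType) (G : graph V E) : {set {set E}} :=
  [set A : {set E} | ~~ [exists C : {set E}, (C \subset A) && is_cycle G C]].

Lemma free_imageP (K : fieldType) (vT : vectType K) (E : finType)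
    (f : E -> vT) (A : {set E}) :
  (forall k : E -> K, \sum_(e in A) k e *: f e = 0 ->
     forall e, e \in A -> k e = 0) <-> free [seq f e | e in A].
Proof.
pose X := [tuple of map f (enum_tuple A)].
have XE : X = [seq f e | e in A] :> seq vT by [].
rewrite -XE; split=> [h | /freeP h k].
  apply/freeP => k sk i.
  pose e := tnth (enum_tuple A) i.
  have eA : e \in A by rewrite -mem_enum mem_tnth.
  pose k' x := if insub (index x (enum A)) is Some j then k j else 0.
  have k'E j : k' (tnth (enum_tuple A) j) = k j.
    rewrite /k' (tnth_nth e) index_uniq ?enum_uniq -?cardE //.
    by rewrite -[nat_of_ord j]/(val j) valK.
  rewrite -(k'E i); apply: h => //; rewrite -[RHS]sk.
  rewrite -big_enum /= (big_tuple _ _ (enum_tuple A) predT).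
  apply: eq_bigr => j _; rewrite k'E; congr (_ *: _).
  by rewrite -tnth_nth tnth_map.
move=> sk e eA.
have ltA : (index e (enum A) < #|A|)%N by rewrite cardE index_mem mem_enum.
have := h (fun j => k (tnth (enum_tuple A) j)) _ (Ordinal ltA).
rewrite (tnth_nth e) /= nth_index ?mem_enum //; apply.
rewrite -[RHS]sk -[RHS]big_enum /= [RHS](big_tuple _ _ (enum_tuple A) predT).
by apply: eq_bigr => j _; rewrite -tnth_nth tnth_map.
Qed.

Lemma F2_cases (x : 'F_2) : x = (x != 0)%:R.
Proof. by case: x => [[|[|x]] lx] //; apply: val_inj. Qed.

Lemma free_imageF2P (vT : vectType 'F_2) (E : finType) (f : E -> vT)
    (A : {set E}) :
  (forall C : {set E}, C \subset A -> \sum_(e in C) f e = 0 -> C = set0) <->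
  free [seq f e | e in A].
Proof.
split=> [h | /free_imageP h C sCA sC].
  apply/free_imageP => k sk e eA.
  have /setP/(_ e) : [set x in A | k x != 0] = set0.
    apply: h; first by apply/subsetP => x; rewrite inE => /andP[].
    rewrite -[RHS]sk big_mkcond [RHS]big_mkcond; apply: eq_bigr => x _.
    rewrite inE; case: (x \in A) => //=.
    by rewrite {2}[k x]F2_cases; case: (k x != 0); rewrite ?scale1r ?scale0r.
  by rewrite !inE eA /= => /negbFE/eqP.
apply/setP => e; rewrite inE; apply/negP => eC.
have := h (fun x => (x \in C)%:R) _ e (subsetP sCA _ eC).
rewrite eC => /(_ _)/eqP; rewrite oner_eq0 => /(_ _)/notF; apply.
rewrite -[RHS]sC big_mkcond [RHS]big_mkcond; apply: eq_bigr => x _.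
case xC: (x \in C); first by rewrite (subsetP sCA) // scale1r.
by rewrite scale0r if_same.
Qed.

Section CycleMatroid.
Variables (V E : finType) (G : graph V E).

Definition star_val (v : V) (S : {set V}) : 'F_2 :=
  ((#|S| == 2%N) && (v \in S))%:R.

Lemma star_val2 v a b : star_val v [set a; b] = (v == a)%:R + (v == b)%:R.
Proof.
rewrite /star_val cards2 !inE; have [->|ab] := eqVneq a b.
  by case: (v == b); apply: val_inj.
rewrite /=; have [->|//] := eqVneq v a.
  by rewrite (negbTE ab) addr0.
by rewrite add0r.
Qed.

Lemma cycle_sum0 (C : {set E}) : is_cycle G C ->
  \sum_(e in C) column (incidence G) e = 0.
Proof.
case/andP => _ /existsP[vs /existsP[es /and3P[_ /eqP eC /eqP eE]]].
have ues : uniq es.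
  apply/card_uniqP; rewrite size_tuple -[in RHS]eC.
  by apply: eq_card => x; rewrite inE.
apply/ffunP => v; rewrite sum_ffunE ffunE.
have -> : \sum_(e in C) column (incidence G) e v
        = \sum_(e <- es) star_val v (ends G e).
  rewrite big_uniq //=; apply: eq_big => [e|e _]; last by rewrite ffunE.
  by rewrite -[in LHS]eC inE.
rewrite -(big_map (ends G) predT (star_val v)) eE big_map.
under eq_bigr do rewrite star_val2.
rewrite big_split /= -(big_map fst predT (fun a => (v == a)%:R)).
rewrite -(big_map snd predT (fun a => (v == a)%:R)) /=.
rewrite -/(unzip1 _) -/(unzip2 _) unzip1_zip ?size_rot //.
rewrite unzip2_zip ?size_rot //.
rewrite [X in _ + X](perm_big vs) ?perm_rot //=.
by rewrite -mulr2n -mulr_natr (_ : 2%:R = 0) ?mulr0 //; apply: val_inj.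
Qed.

Fixpoint trail (C : {set E}) (v : V) (p : seq (E * V)) : bool :=
  if p is q :: p' then
    [&& q.1 \in C, ends G q.1 == [set v; q.2] & trail C q.2 p']
  else true.

Lemma trail_cat C v p1 p2 : trail C v (p1 ++ p2) =
  trail C v p1 && trail C (last v (unzip2 p1)) p2.
Proof. by elim: p1 v => //= q p1 IH v; rewrite IH !andbA. Qed.

Lemma trail_sub C v p : trail C v p -> {subset unzip1 p <= C}.
Proof.
elim: p v => //= q p IH v /and3P[qC _ /IH{}IH] e.
by rewrite inE => /predU1P[-> // | /IH].
Qed.

Lemma trail_notin C v p u : trail C v p -> u \notin v :: unzip2 p ->
  forall e, e \in unzip1 p -> u \notin ends G e.
Proof.
elim: p v => //= q p IH v /and3P[_ /eqP eq tp].
rewrite !inE !negb_or => /and3P[uv uq up] e /predU1P[->|].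
  by rewrite eq !inE negb_or uv.
by apply: IH tp _ e; rewrite inE negb_or uq.
Qed.

Lemma trail_uniq C v p : trail C v p -> uniq (v :: unzip2 p) ->
  uniq (unzip1 p).
Proof.
elim: p v => //= q p IH v /and3P[_ /eqP eq tp] /andP[vp up].
rewrite (IH _ tp up) andbT; apply/negP => qp.
by have := trail_notin tp vp qp; rewrite eq !inE eqxx.
Qed.

Lemma trail_ends C v p e w : trail C v p ->
  ends G e = [set last v (unzip2 p); w] ->
  [seq ends G x | x <- rcons (unzip1 p) e]
  = [seq [set x.1; x.2] | x <- zip (v :: unzip2 p) (rcons (unzip2 p) w)].
Proof.
elim: p v => [|q p IH] v /=; first by move=> _ ->.
by move=> /and3P[_ /eqP-> tp] /(IH _ tp) ->.
Qed.

Lemma cycle_of_seqs (C : {set E}) (vs : seq V) (es : seq E) :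
  es != [::] -> uniq vs -> uniq es -> {subset es <= C} ->
  size vs = size es ->
  [seq ends G e | e <- es] = [seq [set p.1; p.2] | p <- zip vs (rot 1 vs)] ->
  exists2 C' : {set E}, C' \subset C & is_cycle G C'.
Proof.
move=> es0 uvs ues sC sz eE; exists [set:: es].
  by apply/subsetP => e; rewrite inE => /sC.
have cE : #|[set:: es]| = size es.
  by rewrite -(card_uniqP ues); apply: eq_card => x; rewrite inE.
apply/andP; split.
  case: es es0 {ues sC sz eE cE} => // e es _.
  by apply/set0Pn; exists e; rewrite !inE eqxx.
have vsP : size vs == #|[set:: es]| by rewrite sz cE.
have esP : size es == #|[set:: es]| by rewrite cE.
apply/existsP; exists (Tuple vsP); apply/existsP; exists (Tuple esP).
by rewrite /= uvs eqxx eE eqxx.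
Qed.

Lemma even_has_cycle (C : {set E}) : C != set0 ->
  \sum_(e in C) column (incidence G) e = 0 ->
  exists2 C' : {set E}, C' \subset C & is_cycle G C'.
Proof.
move=> C0 sC.
have [/exists_inP[e eC loop] | noloop] :=
    boolP [exists e in C, #|ends G e| == 1%N].
  have [v ve] := cards1P loop.
  apply: (@cycle_of_seqs C [:: v] [:: e]) => //=.
    by move=> x; rewrite inE => /eqP->.
  by rewrite ve setUid.
have card2 e : e \in C -> #|ends G e| = 2%N.
  move=> eC; have := endsP G e.
  have : #|ends G e| != 1%N.
    by apply: contra noloop => h; apply/exists_inP; exists e.
  by case: #|ends G e| => [|[|[|]]].
have other e v : e \in C -> v \in ends G e ->
    exists e' u, [/\ e' \in C, e' != e, u != v & ends G e' = [set u; v]].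
  move=> eC ve.
  have [e' /and3P[e'C nee' ve']] :
      exists e', [&& e' \in C, e' != e & v \in ends G e'].
    apply/existsP; apply: contraT => /existsPn no.
    move/ffunP/(_ v): sC; rewrite sum_ffunE ffunE (bigD1 e) //= big1 => [|x].
      by rewrite ffunE /incidence card2 // ve addr0 => /eqP; rewrite oner_eq0.
    move=> /andP[xC xe]; rewrite ffunE /incidence.
    by have := no x; rewrite xC xe /= => /negbTE ->; rewrite andbF.
  have /eqP/cards2P[a [b [ab eab]]] := card2 _ e'C.
  move: ve'; rewrite eab !inE => /orP[] /eqP ->.
    by exists e', b; split; rewrite // 1?eq_sym // eab setUC.
  by exists e', a; split.
have base : exists v p, [/\ p != [::], trail C v p & uniq (v :: unzip2 p)].
  have [e eC] := set0Pn _ C0.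
  have /eqP/cards2P[a [b [ab eab]]] := card2 _ eC.
  by exists a, [:: (e, b)]; rewrite /= eC eab eqxx inE ab.
have [v [p [p0 tp up]]] := base.
have [n] := ubnP (#|V| - size p); elim: n v p p0 tp up {base} => // n IH v p.
case: p => // -[e0 w] p _ tp up ltn.
have [e0C /eqP ee0 tw] : [/\ e0 \in C, ends G e0 == [set v; w] & trail C w p].
  by case/and3P: tp.
have [|e [u [eC nee0 uv eu]]] := other e0 v e0C; first by rewrite ee0 !inE eqxx.
have [uin | unin] := boolP (u \in unzip2 ((e0, w) :: p)); last first.
  apply: (IH u ((e, v) :: (e0, w) :: p)) => //.
  - by move: tp => /= ->; rewrite eC eu eqxx.
  - rewrite [unzip2 _]/= -/(unzip2 ((e0, w) :: p)).
    by rewrite cons_uniq up andbT inE negb_or uv.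
  have szV : (size (v :: unzip2 ((e0, w) :: p)) <= #|V|)%N.
    by rewrite -(card_uniqP up) max_card.
  move: szV ltn; rewrite /= size_map => szV ltn.
  rewrite -ltnS; apply: leq_trans ltn.
  by rewrite ltnS ltn_sub2l // ltnW.
have [p1 [p2 [ep lp]]] : exists p1 p2, (e0, w) :: p = p1 ++ p2 /\
    p1 != [::] /\ last v (unzip2 p1) = u.
  set q := (e0, w) :: p; set i := index u (unzip2 q).
  exists (take i.+1 q), (drop i.+1 q); rewrite cat_take_drop; do 2?split=> //.
  rewrite /unzip2 map_take -/(unzip2 q) (take_nth v) ?index_mem //.
  by rewrite last_rcons nth_index.
case: lp => p10 lp.
case: p1 p10 ep lp => // q p1 _ /= [<- ep] lp.
rewrite ep in tp up.
have tp1 : trail C v ((e0, w) :: p1).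
  by move: tp; rewrite -cat_cons trail_cat => /andP[].
have up1 : uniq (v :: unzip2 ((e0, w) :: p1)).
  by move: up; rewrite -cat_cons /unzip2 map_cat -cat_cons cat_uniq => /and3P[].
apply: (@cycle_of_seqs C (v :: unzip2 ((e0, w) :: p1))
                         (rcons (unzip1 ((e0, w) :: p1)) e)) => //.
- rewrite rcons_uniq (trail_uniq tp1 up1) andbT /= inE negb_or nee0 /=.
  apply/negP => ep1.
  have [_ _ tw1] : [/\ true, true & trail C w p1] by case/and3P: tp1.
  have := @trail_notin C w p1 v tw1 _ e ep1.
  by rewrite eu !inE eqxx orbT => h; case/andP: up1 => vv _; move: (h vv).
- by move=> x; rewrite mem_rcons inE => /predU1P[-> //|]; apply: trail_sub tp1 _.
- by rewrite size_rcons /= !size_map.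
rewrite rot1_cons; apply: trail_ends tp1 _.
by rewrite eu -lp.
Qed.

Lemma forestsE : forests G = vector_indep (incidence G).
Proof.
apply/setP => A; rewrite !inE; apply/idP/idP => [noC | fA].
  apply/free_imageF2P => C sCA sC; apply/eqP; apply: contraT => C0.
  have [C' sC' cC'] := even_has_cycle C0 sC.
  move/existsPn/(_ C'): noC; rewrite cC' andbT.
  by rewrite (subset_trans sC' sCA).
apply/existsPn => C; apply/negP => /andP[sCA cC].
have C0 := (free_imageF2P _ _).2 fA C sCA (cycle_sum0 cC).
by move: cC; rewrite C0 /is_cycle eqxx.
Qed.

Lemma forests_axiom : matroid_axiom (forests G).
Proof. by rewrite forestsE vector_axiom. Qed.

End CycleMatroid.

Definition cycle_matroid (V E : finType) (G : graph V E) : matroid E :=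
  Matroid (forests_axiom G).

Definition even_cycle_matroid (V E : finType) (G : graph V E) (W : {set E}) :
    matroid E :=
  vector_matroid (add_row (fun e => (e \in W)%:R) (incidence G)).

(* Vertex sets are arbitrary and edges are labelled by the elements of [M], so
   this class is closed under isomorphism. *)
Definition is_even_cycle : matroid_class := fun E M =>
  exists (V : finType) (G : graph V E) (W : {set E}),
    M = even_cycle_matroid G W.

Definition graph_delete (V E : finType) (G : graph V E) (F : {set E}) :
    graph V {e : E | e \notin F} :=
  @Graph V {e : E | e \notin F} (fun e => ends G (val e))
    (fun e => endsP G (val e)).

Definition adjacent_edges (V E : finType) (G : graph V E) (e f : E) : bool :=
  (e != f) && ~~ [disjoint ends G e & ends G f].

Lemma complete_endsP (n : nat) (e : {S : {set 'I_n} | #|S| == 2%N}) :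
  (0 < #|val e| <= 2)%N.
Proof. by rewrite (eqP (valP e)). Qed.

Definition complete_graph (n : nat) :
    graph 'I_n {S : {set 'I_n} | #|S| == 2%N} := Graph (@complete_endsP n).

(** * The three matroids *)

(* Over GF(2) the points of PG(3,2) are the nonzero vectors of GF(2)^4. *)
Definition PG32_point : finType := {v : 'cV['F_2]_4 | v != 0}.

Definition PG32 : matroid PG32_point :=
  vector_matroid (fun (i : 'I_4) (v : PG32_point) => val v i 0).

(* [e] and [f] are meant to be adjacent edges of K_7; all choices give
   isomorphic matroids. *)
Definition L19 (e f : {S : {set 'I_7} | #|S| == 2%N}) :
    matroid {x : {S : {set 'I_7} | #|S| == 2%N} | x \notin [set e; f]} :=
  dual (cycle_matroid (graph_delete (complete_graph 7) [set e; f])).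

Definition L11_rows : seq (seq nat) :=
  [:: [:: 1; 0; 0; 0; 0; 0; 1; 0; 1; 0; 1];
      [:: 0; 1; 0; 0; 0; 0; 1; 0; 0; 1; 1];
      [:: 0; 0; 1; 0; 0; 0; 0; 1; 1; 1; 0];
      [:: 0; 0; 0; 1; 0; 0; 0; 1; 1; 0; 1];
      [:: 0; 0; 0; 0; 1; 0; 0; 1; 0; 1; 1];
      [:: 0; 0; 0; 0; 0; 1; 0; 0; 1; 1; 1]]%N.

Definition L11_matrix : 'M['F_2]_(6, 11) :=
  \matrix_(i < 6, j < 11) (nth 0%N (nth [::] L11_rows i) j)%:R.

Definition L11 : matroid 'I_11 := vector_matroid L11_matrix.

(* Main.v *)
Require Import Defs.
From HB Require Import structures.
From mathcomp Require Import all_boot all_order all_algebra.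

(**
A binary matroid is determined by its cycle space, the sets of elements whose
columns sum to zero; duality is orthogonality, deletion is restriction and
contraction is projection of cycle spaces. A matroid is an even-cycle matroid
iff its cocycle space is spanned by a set [w] and the rows of the incidence
matrix of a graph.

If such a matroid has rank r >= 2, at least r of these rows are nonzero, since
they sum to zero and span a space of dimension at least r - 1. Every column has
at most two ones in these rows, so r times the cogirth is at most twice the
number of elements. For L19 and L11 this would give 13 * 3 <= 2 * 19 and
6 * 4 <= 2 * 11. For PG(3,2) minus a point a parity argument on a plane applies.

Even-cycle matroids are closed under minors, so it suffices to exhibit graphs
for the deletion and the contraction of each single element. These are given by
explicit sums of rows and checked by computation, for L19 up to the symmetries
of K7 minus two adjacent edges.
*)

Set Implicit Arguments.
Unset Strict Implicit.
Unset Printing Implicit Defensive.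

Import GRing.Theory.

(** * Cycle spaces of binary matroids *)

(** Contraction is defined through duals, bases and subtypes, and an even-cycle matroid by an
    existential over graphs. Cycle spaces bring both to one form: a minor becomes a condition on
    subsets of the original ground set, and equality of matroids becomes equality of spaces.

    For L19 the rank 13 is 19 - 6 and the cogirth 3 is the girth of a simple graph; the bound fails
    by one. For PG(3,2) minus a point, of rank 4 and cogirth 7 on 14 elements, it holds with
    equality, 4 * 7 = 2 * 14, so another argument is needed there. Every graph exhibited for a minor
    of rank r attains the least possible number r of vertices. *)

Section Parity.
Variable E : finType.
Implicit Types (X Y C : {set E}) (f g : E -> bool).

(** Sets are vectors over GF(2) with [symdiff] as addition; [parity [in Y] X] is the standard
    bilinear form. *)
Definition parity f X : bool := \big[addb/false]_(e in X) f e.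

Definition symdiff X Y : {set E} := [set e | (e \in X) (+) (e \in Y)].

Lemma parityE f X : parity f X = \big[addb/false]_e ((e \in X) && f e).
Proof.
by rewrite /parity big_mkcond; apply: eq_bigr => e _; case: (e \in X).
Qed.

Lemma in_symdiff X Y e : (e \in symdiff X Y) = (e \in X) (+) (e \in Y).
Proof. by rewrite inE. Qed.

Lemma symdiff0 X : symdiff X set0 = X.
Proof. by apply/setP => e; rewrite in_symdiff inE addbF. Qed.

Lemma symdiffxx X : symdiff X X = set0.
Proof. by apply/setP => e; rewrite in_symdiff addbb inE. Qed.

Lemma symdiffK X Y : symdiff (symdiff X Y) Y = X.
Proof. by apply/setP => e; rewrite !in_symdiff addbK. Qed.

Lemma symdiffC X Y : symdiff X Y = symdiff Y X.
Proof. by apply/setP => e; rewrite !in_symdiff addbC. Qed.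

Lemma symdiffA X Y C : symdiff X (symdiff Y C) = symdiff (symdiff X Y) C.
Proof. by apply/setP => e; rewrite !in_symdiff addbA. Qed.

Lemma symdiffACA X Y X' Y' :
  symdiff (symdiff X Y) (symdiff X' Y') = symdiff (symdiff X X') (symdiff Y Y').
Proof. by apply/setP => e; rewrite !in_symdiff addbACA. Qed.

Lemma symdiff_eq0 X Y : symdiff X Y = set0 -> X = Y.
Proof.
move=> XY; apply/setP => e; move/setP/(_ e): XY; rewrite in_symdiff inE.
by do 2!case: (_ \in _).
Qed.

Lemma symdiff_sub X Y C : X \subset C -> Y \subset C -> symdiff X Y \subset C.
Proof.
move=> /subsetP sX /subsetP sY; apply/subsetP => e; rewrite in_symdiff.
by have [/sX-> | _ /sY] := boolP (e \in X).
Qed.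

Lemma eq_parity f g X : {in X, f =1 g} -> parity f X = parity g X.
Proof. by move=> fg; apply: eq_bigr. Qed.

Lemma parity0 f : parity f set0 = false.
Proof. by rewrite /parity big_set0. Qed.

Lemma parity1 f e : parity f [set e] = f e.
Proof. by rewrite /parity big_set1. Qed.

Lemma parity_symdiff f X Y : parity f (symdiff X Y) = parity f X (+) parity f Y.
Proof.
rewrite !parityE -big_split; apply: eq_bigr => e _.
by rewrite in_symdiff andb_addl.
Qed.

Lemma parity_addb f g X :
  parity (fun e => f e (+) g e) X = parity f X (+) parity g X.
Proof. exact: big_split. Qed.

Lemma parity_sum (I : Type) (s : seq I) (F : I -> E -> bool) X :
  parity (fun e => \big[addb/false]_(i <- s) F i e) X =
  \big[addb/false]_(i <- s) parity (F i) X.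
Proof. exact: exchange_big. Qed.

Lemma parity_andb (b : bool) f X :
  parity (fun e => b && f e) X = b && parity f X.
Proof. by rewrite /parity big_distrr. Qed.

Lemma parity_memC X Y : parity [in Y] X = parity [in X] Y.
Proof. by rewrite !parityE; apply: eq_bigr => e _; rewrite andbC. Qed.

End Parity.

Lemma parity_imset (E F : finType) (h : F -> E) (f : E -> bool) (X : {set F}) :
  injective h -> parity f (h @: X) = parity (f \o h) X.
Proof. by move=> hI; rewrite /parity big_imset //= => x y _ _; apply: hI. Qed.

Section CycleSpace.
Variable E : finType.
Implicit Types (X Y C : {set E}) (Z : {set {set E}}) (M : matroid E).

Definition linear_space Z : Prop :=
  set0 \in Z /\ forall X Y, X \in Z -> Y \in Z -> symdiff X Y \in Z.

Definition orth Z : {set {set E}} :=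
  [set Y : {set E} | [forall C in Z, ~~ parity [in Y] C]].

Lemma orthP Z Y :
  reflect (forall C, C \in Z -> parity [in Y] C = false) (Y \in orth Z).
Proof.
rewrite inE; apply: (iffP forall_inP) => h C CZ; first exact/negbTE/h.
by rewrite h.
Qed.

Lemma orth_linear Z : linear_space (orth Z).
Proof.
split=> [|X Y /orthP oX /orthP oY]; apply/orthP => C CZ.
  by rewrite parity_memC parity0.
rewrite parity_memC parity_symdiff.
by rewrite (parity_memC X) (parity_memC Y) oX // oY.
Qed.

(* A maximal linear space containing [Z] but not [Y] has index two, so
   membership in it is the parity of the intersection with a fixed set. *)
Lemma orth_separates Z Y : linear_space Z -> Y \notin Z ->
  exists2 U, U \in orth Z & parity [in U] Y.
Proof.
move=> [Z0 ZD] YZ.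
pose good (Z' : {set {set E}}) := [&& set0 \in Z',
  [forall A in Z', forall B in Z', symdiff A B \in Z'] & Y \notin Z'].
have gZ : good Z.
  rewrite /good Z0 YZ andbT /=.
  by apply/forall_inP => A AZ; apply/forall_inP => B BZ; apply: ZD.
have [Z1 /maxsetP[/and3P[Z10 /forall_inP Z1D YZ1] Z1max] sZ] :=
  maxset_exists gZ.
have {}Z1D A B : A \in Z1 -> B \in Z1 -> symdiff A B \in Z1.
  by move=> AZ BZ; have /forall_inP := Z1D _ AZ; apply.
(* [Z2], generated by [Z1] and [A], is strictly larger, so by maximality it contains [Y]. *)
have Z1or A : A \notin Z1 -> symdiff A Y \in Z1.
  move=> AZ1; apply: contraT => AYZ1.
  pose Z2 := Z1 :|: [set C : {set E} | symdiff C A \in Z1].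
  suff g2 : good Z2.
    have e21 := Z1max _ g2 (subsetUl _ _).
    move: AZ1; rewrite -e21 !inE.
    by rewrite symdiffxx Z10 orbT.
  apply/and3P; split; rewrite ?inE ?Z10 ?negb_or ?YZ1 ?[symdiff Y A]symdiffC //.
  apply/forall_inP => B; rewrite 2!inE => BZ2; apply/forall_inP => C.
  rewrite 2!inE => CZ2; rewrite 2!inE.
  case/orP: BZ2 => BZ2; case/orP: CZ2 => CZ2.
  - by rewrite (Z1D B C).
  - by rewrite -symdiffA (Z1D B _ BZ2 CZ2) orbT.
  - by rewrite [symdiff B C]symdiffC -symdiffA (Z1D C _ CZ2 BZ2) orbT.
  - by have := Z1D _ _ BZ2 CZ2; rewrite symdiffACA symdiffxx symdiff0 => ->.
have Z1lin A B : (symdiff A B \notin Z1) = (A \notin Z1) (+) (B \notin Z1).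
  have h C D : C \in Z1 -> (symdiff C D \in Z1) = (D \in Z1).
    move=> CZ1; apply/idP/idP => [h|]; last exact: Z1D.
    by rewrite -(symdiffK D C) symdiffC [symdiff D C]symdiffC Z1D.
  case AZ: (A \in Z1); first by rewrite h.
  case BZ: (B \in Z1); first by rewrite symdiffC h // AZ.
  have := Z1D _ _ (Z1or _ (negbT AZ)) (Z1or _ (negbT BZ)).
  by rewrite symdiffACA symdiffxx symdiff0 => ->.
(* Being outside [Z1] is additive modulo 2, hence determined by its values on singletons. *)
pose U := [set e | [set e] \notin Z1].
have UE C : (C \notin Z1) = parity [in U] C.
  have [n] := ubnP #|C|; elim: n C => // n IHn C leC.
  have [->|[e eC]] := set_0Vmem C; first by rewrite parity0 Z10.
  have eCE : C = symdiff [set e] (C :\ e).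
    apply/setP => x; rewrite in_symdiff !inE.
    by case: eqP => [->|_] /=; rewrite ?eC.
  have ltC : (#|C :\ e| < n)%N by move: leC; rewrite (cardsD1 e C) eC.
  by rewrite eCE Z1lin parity_symdiff parity1 (IHn _ ltC) inE.
exists U; last by rewrite -UE.
by apply/orthP => C CZ; rewrite -UE (subsetP sZ).
Qed.

Lemma orthK Z : linear_space Z -> orth (orth Z) = Z.
Proof.
move=> lZ; apply/setP => Y; apply/idP/idP => [/orthP oY | YZ].
  apply: contraT => /(orth_separates lZ)[U UZ].
  by rewrite parity_memC oY.
by apply/orthP => C /orthP oC; rewrite parity_memC oC.
Qed.

Definition represents M Z : Prop := linear_space Z /\
  forall X, X \in indep M <-> forall C, C \in Z -> C \subset X -> C = set0.

Lemma represents_dependent M Z X : represents M Z -> X \notin indep M ->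
  exists C, [/\ C \in Z, C \subset X & C != set0].
Proof.
move=> [_ MZ] XM.
have [/exists_inP[C CZ /andP[CX C0]] | no] :=
    boolP [exists C in Z, (C \subset X) && (C != set0)]; first by exists C.
case/negP: XM; apply/MZ => C CZ CX; apply/eqP; apply: contraNT no => C0.
by apply/exists_inP; exists C; rewrite // CX.
Qed.

Lemma circuit_through M Z B c : represents M Z -> B \in indep M ->
  c |: B \notin indep M -> exists Y, [/\ Y \in Z, Y \subset c |: B & c \in Y].
Proof.
move=> rZ BM depB; have [Y [YZ YB Y0]] := represents_dependent rZ depB.
exists Y; split=> //; apply: contraNT Y0 => cY; apply/eqP.
apply: ((proj2 rZ) B).1 => //; apply/subsetP => y yY.
have := subsetP YB y yY; rewrite !inE; case: eqP => // yc.
by rewrite -yc yY in cY.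
Qed.

Lemma represents_matroid_eq M N Z : represents M Z -> represents N Z -> M = N.
Proof.
move=> [_ MZ] [_ NZ]; apply: matroid_eq; apply/setP => X.
by apply/idP/idP => [/MZ/NZ | /NZ/MZ].
Qed.

(** Induction on the size of a cycle. Both spaces have the same dependent sets, so a minimal
    nonempty member [C2] of [Z'] inside the cycle lies in both, and subtracting it leaves a smaller
    cycle. *)
Lemma represents_sub M Z Z' : represents M Z -> represents M Z' -> Z \subset Z'.
Proof.
move=> rZ rZ'; have [[Z0 ZD] MZ] := rZ; have [[Z'0 Z'D] MZ'] := rZ'.
apply/subsetP => C; have [n] := ubnP #|C|; elim: n C => // n IHn C leC CZ.
have [->//|C0] := eqVneq C set0.
have depC : C \notin indep M.
  by apply/negP => /MZ/(_ _ CZ (subxx _))/eqP; apply/negP.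
pose P C' := [&& C' \in Z', C' \subset C & C' != set0].
have [C1 C1P] : exists C', P C'.
  by have [C' []] := represents_dependent rZ' depC; exists C'; apply/and3P.
have [C2 /minsetP[/and3P[C2Z' C2C C20] C2min] _] := minset_exists C1P.
have depC2 : C2 \notin indep M.
  by apply/negP => /MZ'/(_ _ C2Z' (subxx _))/eqP; apply/negP.
have [C3 [C3Z C3C2 C30]] := represents_dependent rZ depC2.
have depC3 : C3 \notin indep M.
  by apply/negP => /MZ/(_ _ C3Z (subxx _))/eqP; apply/negP.
have [C4 [C4Z' C4C3 C40]] := represents_dependent rZ' depC3.
have C42 : C4 = C2.
  apply: C2min; last exact: subset_trans C4C3 C3C2.
  by rewrite /P C4Z' C40 (subset_trans (subset_trans C4C3 C3C2)).
have C32 : C3 = C2 by apply/eqP; rewrite eqEsubset C3C2 -C42.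
rewrite C32 in C3Z; rewrite -(symdiffK C C2); apply: Z'D => //.
apply: IHn (ZD _ _ CZ C3Z); rewrite -ltnS; apply: leq_trans leC; rewrite ltnS.
apply: proper_card; apply/properP; split; first exact: symdiff_sub.
have [e eC2] := set0Pn _ C20.
by exists e; rewrite ?in_symdiff ?eC2 (subsetP C2C).
Qed.

Lemma represents_uniq M Z Z' : represents M Z -> represents M Z' -> Z = Z'.
Proof.
move=> rZ rZ'; apply/eqP; rewrite eqEsubset.
by rewrite (represents_sub rZ rZ') (represents_sub rZ' rZ).
Qed.

(** A nonempty cocycle inside the complement of a basis [B] would meet the fundamental circuit of
    any of its elements [c] in [c] alone. Conversely, if [X] contains no nonempty cocycle, its
    complement spans and so contains a basis. *)
Lemma represents_dual M Z : represents M Z -> represents (dual M) (orth Z).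
Proof.
move=> rZ; have [[Z0 ZD] MZ] := rZ; split=> [|X]; first exact: orth_linear.
split=> [|noX].
  rewrite inE => /existsP[B /andP[/maxsetP[BM Bmax] XB]] C /orthP oC CX.
  apply/setP => c; rewrite inE; apply/negP => cC.
  have cB : c \notin B by have := subsetP XB c (subsetP CX c cC); rewrite inE.
  have depB : c |: B \notin indep M.
    by apply/negP => /Bmax/(_ (subsetUr _ _)) eB; move: cB; rewrite -eB setU11.
  have [Y [YZ YB cY]] := circuit_through rZ BM depB.
  have := oC _ YZ; rewrite parityE (bigD1 c) //= cY cC big1 // => e ec.
  apply/negbTE/negP => /andP[eY eC]; have := subsetP YB _ eY.
  rewrite !inE (negbTE ec) /=; have := subsetP XB e (subsetP CX e eC).
  by rewrite inE => /negP.
(* The complement of [X] spans: a cocycle separating a set from [span] would be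
   contained in [X]. *)
pose span := [set Y : {set E} |
  [exists C : {set E}, (C \subset ~: X) && (symdiff Y C \in Z)]].
have spanL : linear_space span.
  split=> [|A B]; rewrite !inE.
    by apply/existsP; exists set0; rewrite sub0set symdiff0.
  move=> /existsP[C /andP[CX CZ]] /existsP[D /andP[DX DZ]].
  by apply/existsP; exists (symdiff C D); rewrite symdiff_sub // symdiffACA ZD.
have spanT Y : Y \in span.
  apply: contraT => /(orth_separates spanL)[U /orthP oU].
  suff -> : U = set0 by rewrite parity_memC parity0.
  apply: noX.
    apply/orthP => C CZ; apply: oU; rewrite inE; apply/existsP; exists set0.
    by rewrite sub0set symdiff0.
  apply/subsetP => u uU; apply: contraT => uX.
  suff /oU : [set u] \in span by rewrite parity1 /= uU.
  rewrite inE.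
  apply/existsP; exists [set u]; rewrite sub1set inE uX.
  by rewrite symdiffxx.
pose P B := (B \in indep M) && (B \subset ~: X).
have P0 : P set0 by rewrite /P indep0 sub0set.
have [B /maxsetP[/andP[BM BX] Bmax] _] := maxset_exists P0.
rewrite inE; apply/existsP; exists B; rewrite subsetC BX andbT.
(* Adding fundamental circuits of [B] removes the elements outside [B] one at a time. *)
have red C : C \subset ~: X ->
    exists2 D : {set E}, D \subset B & symdiff C D \in Z.
  have [n] := ubnP #|C :\: B|; elim: n C => // n IHn C leC CX.
  have [C0|[c /setDP[cC cB]]] := set_0Vmem (C :\: B).
    exists C; first by rewrite -setD_eq0 C0.
    by rewrite symdiffxx.
  have depB : c |: B \notin indep M.
    apply/negP => cBM; have /Bmax/(_ (subsetUr _ _)) eB : P (c |: B).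
      by rewrite /P cBM subUset sub1set (subsetP CX).
    by move: cB; rewrite -eB setU11.
  have [Y [YZ YB cY]] := circuit_through rZ BM depB.
  have YX : Y \subset ~: X.
    by apply: subset_trans YB _; rewrite subUset sub1set (subsetP CX).
  have [||D DB DZ] := IHn (symdiff C Y); last first.
    exists D => //; rewrite -(symdiffK C Y) -symdiffA [symdiff Y D]symdiffC.
    by rewrite symdiffA ZD.
    exact: symdiff_sub.
  rewrite -ltnS; apply: leq_trans leC; rewrite ltnS.
  apply: proper_card; apply/properP; split.
    apply/subsetP => y; rewrite !inE => /andP[yB]; rewrite yB /=.
    case yC: (y \in C) => //= yY; have := subsetP YB y yY.
    by rewrite !inE (negbTE yB) orbF => /eqP yc; rewrite -yC yc cC.
  by exists c; [rewrite inE cB | rewrite !inE cC cY andbF].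
(* As [~: X] spans, [[set a]] is congruent modulo [Z] to a subset of [B], so [a] cannot be added to
   [B]. *)
apply/maxsetP; split=> // A AM BA; apply/eqP; rewrite eqEsubset BA andbT.
apply/subsetP => a aA; apply: contraT => aB.
have := spanT [set a]; rewrite inE => /existsP[C /andP[CX CZ]].
have [D DB DZ] := red C CX.
have aDZ : symdiff [set a] D \in Z.
  have := ZD _ _ CZ DZ.
  by rewrite -symdiffA (symdiffA C) symdiffxx [symdiff set0 D]symdiffC symdiff0.
have := (MZ A).1 AM _ aDZ; rewrite symdiff_sub ?sub1set ?(subset_trans DB) //.
move=> /(_ isT)/setP/(_ a); rewrite in_symdiff !inE eqxx /=.
by move=> /negbFE/(subsetP DB); rewrite (negbTE aB).
Qed.

End CycleSpace.

Lemma imset_symdiff (E F : finType) (h : F -> E) (X Y : {set F}) :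
  injective h -> h @: symdiff X Y = symdiff (h @: X) (h @: Y).
Proof.
move=> hI; apply/setP => e; rewrite in_symdiff.
apply/imsetP/idP => [[x xXY ->] | ].
  by rewrite !mem_imset // -in_symdiff.
have [/imsetP[x xX ->] | eX /imsetP[x xY ex]] := boolP (e \in h @: X).
  by rewrite mem_imset // => xY; exists x; rewrite // in_symdiff xX.
exists x => //; rewrite in_symdiff xY addbT.
by apply: contra eX => xX; rewrite ex imset_f.
Qed.

(** * Cycle spaces of minors and of binary vector matroids *)

Section Minors.
Variables (E : finType) (M : matroid E) (Z : {set {set E}}).
Hypothesis MZ : represents M Z.

Lemma represents_delete (D : {set E}) :
  represents (delete M D) [set X : {set {x | x \notin D}} | val @: X \in Z].
Proof.
have [[Z0 ZD] MZi] := MZ; split=> [|X].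
  split=> [|X Y]; rewrite !inE ?imset0 // => XZ YZ.
  by rewrite (imset_symdiff _ _ val_inj) ZD.
rewrite inE; split=> [/MZi iX C | iX].
  rewrite inE => CZ CX; have := iX _ CZ (imsetS val CX).
  by move/eqP; rewrite imset_eq0 => /eqP.
apply/MZi => C CZ CX.
have CE : C = val @: (val @^-1: C : {set {x | x \notin D}}).
  apply/setP => c; apply/idP/imsetP => [cC|[x]]; last by rewrite inE => xC ->.
  by have /imsetP[x xX cx] := subsetP CX _ cC; exists x; rewrite // inE -cx.
rewrite CE [val @^-1: C]iX ?imset0 // ?inE -?CE //.
apply/subsetP => x; rewrite inE => /(subsetP CX)/imsetP[y yX].
by move/val_inj->.
Qed.

End Minors.

(** Contraction is the dual of a deletion of the dual, so one inclusion needs separation: a [U]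
    separating [val @: X] from the projected space misses [C], hence is a cocycle that survives the
    deletion. *)
Lemma represents_contract (E : finType) (M : matroid E) (Z : {set {set E}})
    (C : {set E}) : represents M Z ->
  represents (contract M C) [set X : {set {x | x \notin C}} |
    [exists Y : {set E}, (Y \subset C) && (symdiff (val @: X) Y \in Z)]].
Proof.
move=> MZ; have [[Z0 ZD] _] := MZ.
have := represents_dual (represents_delete (represents_dual MZ) C).
rewrite -/(contract M C); congr represents; apply/setP => X.
apply/idP/idP => [/orthP oX|]; last first.
  rewrite inE => /existsP[Y /andP[YC YZ]]; apply/orthP => U.
  rewrite inE => /orthP/(_ _ YZ); rewrite parity_symdiff.
  rewrite (parity_imset _ _ val_inj) [parity _ Y]big1 ?addbF => [<-|y yY].
    rewrite parity_memC; apply: eq_parity => x _ /=.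
    by rewrite mem_imset //; apply: val_inj.
  apply/negbTE/imsetP => -[x _ yx].
  by have := valP x; rewrite /= -yx (subsetP YC).
pose Z' := [set X' : {set E} |
  [exists Y : {set E}, (Y \subset C) && (symdiff X' Y \in Z)]].
have lZ' : linear_space Z'.
  split=> [|A B]; rewrite !inE.
    by apply/existsP; exists set0; rewrite sub0set symdiff0.
  move=> /existsP[Y /andP[YC YZ]] /existsP[Y' /andP[Y'C Y'Z]].
  by apply/existsP; exists (symdiff Y Y'); rewrite symdiff_sub // symdiffACA ZD.
suff : val @: X \in Z' by rewrite !inE.
apply: contraT => /(orth_separates lZ')[U /orthP oU].
have UC c : c \in C -> c \notin U.
  move=> cC; apply/negbT; rewrite -[RHS](oU [set c]) ?parity1 //.
  rewrite inE; apply/existsP; exists [set c].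
  by rewrite sub1set cC symdiffxx.
have UE : U = val @: (val @^-1: U : {set {x | x \notin C}}).
  apply/setP => u; apply/idP/imsetP => [uU|[x]]; last by rewrite inE => xC ->.
  have uC : u \notin C by apply: contraL uU; apply: UC.
  by exists (Sub u uC); rewrite ?inE.
have UZ : (val @^-1: U : {set {x | x \notin C}}) \in
    [set X : {set {x | x \notin C}} | val @: X \in orth Z].
  rewrite inE -UE; apply/orthP => Y YZ; apply: oU.
  by rewrite inE; apply/existsP; exists set0; rewrite sub0set symdiff0.
rewrite (parity_imset _ _ val_inj).
rewrite (_ : parity _ _ = false) // -[RHS](oX _ UZ) parity_memC.
by apply: eq_parity => x _; rewrite /= inE.
Qed.

Lemma represents_minor (E : finType) (M : matroid E) (Z : {set {set E}})
    (C : {set E}) (D : {set {x | x \notin C}}) : represents M Z ->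
  represents (delete (contract M C) D) [set X : {set {x | x \notin D}} |
    [exists Y : {set E}, (Y \subset C)
      && (symdiff ((val \o val) @: X) Y \in Z)]].
Proof.
move=> MZ; have := represents_delete (represents_contract C MZ) D.
by congr represents; apply/setP => X; rewrite !inE imset_comp.
Qed.

Local Open Scope ring_scope.

Lemma F2_addb (a b : bool) : (a (+) b)%:R = a%:R + b%:R :> 'F_2.
Proof. by case: a; case: b; apply: val_inj. Qed.

Lemma sum_F2_eq0 (E : finType) (f : E -> 'F_2) (X : {set E}) :
  (\sum_(e in X) f e == 0) = ~~ parity (fun e => f e != 0) X.
Proof.
have -> : \sum_(e in X) f e = (parity (fun e => f e != 0) X)%:R.
  rewrite /parity (big_morph (fun b : bool => b%:R : 'F_2) F2_addb (erefl _)).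
  by apply: eq_bigr => e _; apply: F2_cases.
by case: (parity _ _); rewrite ?oner_eq0 ?eqxx.
Qed.

Definition kernel (R E : finType) (A : R -> E -> 'F_2) : {set {set E}} :=
  [set X : {set E} | [forall r, ~~ parity (fun e => A r e != 0) X]].

Lemma kernelP (R E : finType) (A : R -> E -> 'F_2) (X : {set E}) :
  reflect (forall r, parity (fun e => A r e != 0) X = false) (X \in kernel A).
Proof.
by rewrite inE; apply: (iffP forallP) => h r; [apply/negbTE | rewrite h].
Qed.

Lemma kernelE (R E : finType) (A : R -> E -> 'F_2) (X : {set E}) :
  (X \in kernel A) = (\sum_(e in X) column A e == 0).
Proof.
have cE r : parity (fun e => column A e r != 0) X =
            parity (fun e => A r e != 0) X.
  by apply: eq_parity => e _; rewrite ffunE.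
apply/kernelP/eqP => [h | h r].
  apply/ffunP => r; rewrite sum_ffunE ffunE; apply/eqP.
  by rewrite sum_F2_eq0 cE h.
by move/ffunP/(_ r)/eqP: h; rewrite sum_ffunE ffunE sum_F2_eq0 cE => /negbTE.
Qed.

Lemma represents_vector (R E : finType) (A : R -> E -> 'F_2) :
  represents (vector_matroid A) (kernel A).
Proof.
split=> [|X].
  split=> [|X Y /kernelP kX /kernelP kY]; apply/kernelP => r.
    by rewrite parity0.
  by rewrite parity_symdiff kX kY.
rewrite inE; split=> [/free_imageF2P fX C | fX].
  by rewrite kernelE => /eqP CA CX; apply: fX.
apply/free_imageF2P => C CX CA; apply: fX => //.
by rewrite kernelE CA.
Qed.

(** * Even-cycle matroids and their minors *)

(** Element [e] is an edge from [p e] to [q e]; for a loop the two tests cancel. Vertices are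
    natural numbers, so that identifying two of them changes no type and certificates can be
    computed. *)
Definition even_cycle_set (E : finType) (w : E -> bool) (p q : E -> nat)
    (X : {set E}) : Prop :=
  parity w X = false /\
  forall v, parity (fun e => (p e == v) (+) (q e == v)) X = false.

Lemma incidence_pair (V E : finType) (G : graph V E) (p q : E -> V) e v :
  ends G e = [set p e; q e] ->
  (incidence G v e != 0) = (p e == v) (+) (q e == v).
Proof.
move=> Ge; rewrite -[incidence G v e]/(star_val v (ends G e)) Ge star_val2.
rewrite -F2_addb ![v == _]eq_sym.
by case: (_ (+) _); rewrite ?oner_eq0 ?eqxx.
Qed.

Lemma even_cycle_kernelP (V E : finType) (G : graph V E) (W : {set E})
    (p q : E -> V) (X : {set E}) : (forall e, ends G e = [set p e; q e]) ->
  X \in kernel (add_row (fun e => (e \in W)%:R) (incidence G)) <->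
  parity [in W] X = false /\
  forall v, parity (fun e => (p e == v) (+) (q e == v)) X = false.
Proof.
move=> Gpq.
have hw e : ((e \in W)%:R : 'F_2) != 0 = (e \in W).
  by case: (e \in W); rewrite ?oner_eq0 ?eqxx.
split=> [/kernelP k | [kw kv]].
  split=> [|v].
    by have := k None; under eq_parity => e _ do rewrite /= hw.
  have := k (Some v).
  by under eq_parity => e _ do rewrite /= (incidence_pair v (Gpq e)).
apply/kernelP => -[v|] /=.
  by under eq_parity => e _ do rewrite (incidence_pair v (Gpq e)).
by under eq_parity => e _ do rewrite hw.
Qed.

Lemma ends_bound (E : finType) (p q : E -> nat) :
  exists N, forall e, (p e < N.+1)%N /\ (q e < N.+1)%N.
Proof.
exists (\max_e maxn (p e) (q e)) => e; rewrite !ltnS.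
by split; apply: leq_trans (leq_bigmax e); rewrite ?leq_maxl ?leq_maxr.
Qed.

Lemma is_even_cycleP (E : finType) (M : matroid E) (Z : {set {set E}}) :
  represents M Z ->
  is_even_cycle M <->
  exists w p q, forall X, X \in Z <-> even_cycle_set w p q X.
Proof.
move=> MZ; split=> [[V [G [W eM]]] | [w [p [q Zpq]]]].
  have /fin_all_exists[p /fin_all_exists[q Gpq]] :
      forall e, exists u, exists v, ends G e = [set u; v].
    move=> e; have := endsP G e; case ce: #|_| => [|[|[|]]] // _.
      by have /eqP/cards1P[v ->] := ce; exists v, v; rewrite setUid.
    by have /eqP/cards2P[u [v [_ ->]]] := ce; exists u, v.
  exists [in W], (fun e => enum_rank (p e) : nat).
  exists (fun e => enum_rank (q e) : nat).
  rewrite eM in MZ; have ZE := represents_uniq MZ (represents_vector _).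
  move=> X; rewrite ZE; apply: (iff_trans (even_cycle_kernelP W X Gpq)).
  have eqr v u : (enum_rank u == enum_rank v :> nat) = (u == v).
    by rewrite val_eqE (inj_eq enum_rank_inj).
  split=> -[kw kv]; split=> // v.
    have [ltv | gev] := ltnP v #|V|; last first.
      rewrite [LHS]big1 // => e _; apply/negbTE; rewrite negb_add.
      by rewrite !ltn_eqF // (leq_trans (ltn_ord _) gev).
    rewrite -(kv (enum_val (Ordinal ltv))); apply: eq_parity => e _.
    by rewrite -!eqr enum_valK.
  by rewrite -(kv (enum_rank v)); apply: eq_parity => e _; rewrite !eqr.
have [N /all_and2[pN qN]] := ends_bound p q.
pose p' e : 'I_N.+1 := inord (p e); pose q' e : 'I_N.+1 := inord (q e).
have GP e : (0 < #|[set p' e; q' e]| <= 2)%N by rewrite cards2; case: (_ != _).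
pose G := Graph GP.
exists 'I_N.+1, G, [set e | w e].
apply: represents_matroid_eq MZ _.
have := represents_vector
  (add_row (fun e => (e \in [set e | w e])%:R) (incidence G)).
congr represents; apply/setP => X.
have KP := @even_cycle_kernelP _ _ G [set e | w e] p' q' X (fun e => erefl _).
have hw : parity (fun e => e \in [set e | w e]) X = parity w X.
  by apply: eq_parity => e _; rewrite inE.
apply/idP/idP => [/KP[kw kv] | /Zpq[kw kv]].
  apply/Zpq; split; first by rewrite -hw.
  move=> v; have [ltv | gev] := ltnP v N.+1; last first.
    rewrite [LHS]big1 // => e _; apply/negbTE; rewrite negb_add.
    by rewrite !ltn_eqF // (leq_trans _ gev).
  rewrite -(kv (Ordinal ltv)); apply: eq_parity => e _.
  by rewrite -!val_eqE /= !inordK.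
apply/KP; split; first by rewrite -kw -hw.
move=> v; rewrite -(kv v); apply: eq_parity => e _.
by rewrite -!val_eqE /= !inordK.
Qed.

Local Close Scope ring_scope.

Section MinorClosed.
Variables (E : finType) (Z : {set {set E}}).
Implicit Types (X Y S C : {set E}) (w : E -> bool) (p q : E -> nat).

(** The minor on [S] obtained by contracting [C], stated on subsets of [E] so that successive
    contractions do not nest subtypes. *)
Definition even_cycle_minor S C : Prop :=
  exists w p q, forall X, X \subset S ->
    (exists2 Y : {set E}, Y \subset C & symdiff X Y \in Z) <->
    even_cycle_set w p q X.

(* A non-loop is made even by adding its end [p x] to [w] (resigning), and
   then [p x] is identified with [q x]; contracting an odd loop forgets [w]. *)
Lemma even_cycle_set_contract w p q x :
  exists w' p' q', forall X, even_cycle_set w' p' q' X <->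
    even_cycle_set w p q X \/ even_cycle_set w p q (symdiff X [set x]).
Proof.
have [pqx | pqx] := eqVneq (p x) (q x).
  have dx X v :
      parity (fun e => (p e == v) (+) (q e == v)) (symdiff X [set x]) =
      parity (fun e => (p e == v) (+) (q e == v)) X.
    by rewrite parity_symdiff parity1 pqx addbb addbF.
  exists (fun e => ~~ w x && w e), p, q => X.
  rewrite /even_cycle_set parity_andb parity_symdiff parity1.
  split=> [[kw kv] | [|] [kw kv]]; last 2 first.
  - by rewrite kw andbF.
  - split=> [|v]; last by rewrite -dx.
    by move: kw; case: (w x) => //=; rewrite addbF.
  case wX: (parity w X); [right | by left]; split=> [|v]; last by rewrite dx.
  by move: kw; rewrite wX; case: (w x).
pose d v e := (p e == v) (+) (q e == v).
pose h v := if v == p x then q x else v.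
exists (fun e => w e (+) (w x && d (p x) e)), (h \o p), (h \o q) => X.
have kwE : parity (fun e => w e (+) (w x && d (p x) e)) X =
           parity w X (+) (w x && parity (d (p x)) X).
  by rewrite parity_addb parity_andb.
(* Merging [p x] into [q x] adds the star of [p x] to that of [q x] and empties the former. *)
have hE v e : ((h \o p) e == v) (+) ((h \o q) e == v) =
    (v != p x) && (d v e (+) ((v == q x) && d (p x) e)).
  have hv u : (h u == v) =
      (v != p x) && ((u == v) (+) ((v == q x) && (u == p x))).
    rewrite /h; have [->|nv] := eqVneq v (p x).
      by case: (eqVneq u (p x)) => [_|/negbTE //]; rewrite eq_sym (negbTE pqx).
    have [->|nu] := eqVneq u (p x); last by rewrite andbF addbF.
    by rewrite eq_sym [p x == v]eq_sym (negbTE nv) andbT.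
  by rewrite /= !hv -andb_addr /d addbACA -andb_addr.
have kvE v : parity (fun e => ((h \o p) e == v) (+) ((h \o q) e == v)) X =
    (v != p x) && (parity (d v) X (+) ((v == q x) && parity (d (p x)) X)).
  rewrite -parity_andb -parity_addb -parity_andb.
  by apply: eq_parity => e _; rewrite hE.
have kxE v : parity (d v) (symdiff X [set x]) =
    parity (d v) X (+) ((v == p x) (+) (v == q x)).
  by rewrite parity_symdiff parity1 /d ![v == _]eq_sym.
rewrite /even_cycle_set kwE parity_symdiff parity1.
split=> [[kw kv] | [|] [kw kv]].
- have {}kv v := etrans (esym (kvE v)) (kv v).
  have kq : parity (d (q x)) X = parity (d (p x)) X.
    have := kv (q x); rewrite eq_sym pqx eqxx /=.
    by do 2!case: (parity _ _).
  (* The parity of [X] at [p x] decides whether [x] must be added. *)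
  case dpX: (parity (d (p x)) X); [right | left]; split.
  + by rewrite -kw dpX andbT.
  + move=> v; rewrite -/(d v) kxE; have := kv v.
    have [->|nvp] := eqVneq v (p x); first by rewrite dpX (negbTE pqx).
    have [->|nvq] := eqVneq v (q x); first by rewrite kq dpX.
    by rewrite /= => ->.
  + by rewrite -kw dpX andbF addbF.
  move=> v; rewrite -/(d v); have := kv v.
  have [->|nvp] := eqVneq v (p x); first by rewrite dpX.
  by rewrite dpX andbF addbF.
- have {}kv v : parity (d v) X = false by exact: kv.
  by split=> [|v]; rewrite ?kvE !kv ?andbF ?kw ?andbF.
have {}kv v : parity (d v) X = (v == p x) (+) (v == q x).
  by have := kv v; rewrite -/(d v) kxE => /negbT; rewrite negb_add => /eqP.
split=> [|v]; last first.
  rewrite kvE !kv eqxx (negbTE pqx) andbT.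
  by case: (v == p x) => //=; rewrite addbb.
by rewrite kv eqxx (negbTE pqx) andbT.
Qed.

Lemma even_cycle_minorS S S' C : S' \subset S ->
  even_cycle_minor S C -> even_cycle_minor S' C.
Proof.
move=> sS [w [p [q H]]]; exists w, p, q => X sX.
by apply: H; apply: subset_trans sX sS.
Qed.

Lemma even_cycle_minor_contract1 S C x : x \in S ->
  even_cycle_minor S C -> even_cycle_minor (S :\ x) (x |: C).
Proof.
move=> xS [w [p [q H]]].
have [w' [p' [q' H']]] := even_cycle_set_contract w p q x.
exists w', p', q' => X /subsetD1P[XS xX].
apply: iff_trans (iff_sym (H' X)).
have HX := H X XS; have HXx := H (symdiff X [set x]).
have {}HXx : symdiff X [set x] \subset S by rewrite symdiff_sub ?sub1set.
have {}HXx := H _ HXx.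
split=> [[Y YC YZ] | [/HX | /HXx] [Y YC YZ]].
- have [xY|xY] := boolP (x \in Y); [right; apply/HXx | left; apply/HX].
    exists (symdiff [set x] Y); last by rewrite symdiffA symdiffK.
    apply/subsetP => y; rewrite in_symdiff inE; have [->|nyx] := eqVneq y x.
      by rewrite xY.
    by move=> /(subsetP YC); rewrite !inE (negbTE nyx).
  exists Y => //; apply/subsetP => y yY; have := subsetP YC _ yY.
  by rewrite !inE; case: eqP => // yx; rewrite -yx yY in xY.
- by exists Y => //; apply: subset_trans YC (subsetUr _ _).
exists (symdiff [set x] Y); last by rewrite symdiffA.
by rewrite symdiff_sub ?subsetUl // (subset_trans YC) ?subsetUr.
Qed.

Lemma even_cycle_minor_contract S C C' : C' \subset S ->
  even_cycle_minor S C -> even_cycle_minor (S :\: C') (C' :|: C).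
Proof.
move=> + SC; have [n] := ubnP #|C'|; elim: n C' => // n IHn C' leC' C'S.
have [->|[x xC']] := set_0Vmem C'; first by rewrite setD0 set0U.
have -> : S :\: C' = (S :\: (C' :\ x)) :\ x.
  apply/setP => y; rewrite !inE.
  by case: (eqVneq y x) => // ->; rewrite xC'.
rewrite -(setD1K xC') setU1K ?setD11 // -setUA.
apply: even_cycle_minor_contract1; first by rewrite !inE eqxx (subsetP C'S).
apply: IHn; last by apply: subset_trans C'S; apply: subD1set.
by move: leC'; rewrite (cardsD1 x C') xC'.
Qed.

(** A proper minor removes some [x]. Starting from the hypothesis for [x], the remaining
    contractions stay in the class, and the remaining deletions only shrink the set on which the
    equivalence is required. *)
Lemma proper_minors_even_cycle (M : matroid E) : represents M Z ->
  (forall x, even_cycle_minor (~: [set x]) set0) ->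
  (forall x, even_cycle_minor (~: [set x]) [set x]) ->
  forall (C : {set E}) (D : {set {x : E | x \notin C}}),
    C != set0 \/ D != set0 -> is_even_cycle (delete (contract M C) D).
Proof.
move=> MZ del con C D CD.
apply/(is_even_cycleP (represents_minor D MZ)).
suff [w [p [q H]]] : even_cycle_minor (~: C :\: val @: D) C.
  pose h := val \o val : {x : {x : E | x \notin C} | x \notin D} -> E.
  have hI : injective h by apply: inj_comp; apply: val_inj.
  exists (w \o h), (p \o h), (q \o h) => X.
  have sX : h @: X \subset ~: C :\: val @: D.
    apply/subsetP => _ /imsetP[x _ ->]; rewrite !inE (valP (val x)) andbT.
    by apply/imsetP => -[y yD /val_inj xy]; have := valP x; rewrite /= xy yD.
  apply: iff_trans (iff_trans (H _ sX) _).
    by rewrite inE; split=> [/existsP[Y /andP[]] | [Y YC YZ]];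
      [exists Y | apply/existsP; exists Y; rewrite YC].
  rewrite /even_cycle_set parity_imset //.
  by split=> -[kw kv]; split=> // v; have := kv v; rewrite parity_imset.
case: CD => [/set0Pn[x xC] | /set0Pn[x xD]].
  have Cx : C :\ x \subset ~: [set x].
    by apply/subsetP => y; rewrite !inE => /andP[].
  have := even_cycle_minor_contract Cx (con x); rewrite setUC setD1K //.
  apply: even_cycle_minorS; apply/subsetP => y; rewrite !inE => /andP[_ yC].
  by rewrite (negbTE yC) andbF; apply: contraNneq yC => ->.
have xC : val x \notin C := valP x.
rewrite -[C in even_cycle_minor _ C]setU0.
apply: even_cycle_minorS (even_cycle_minor_contract _ (del (val x))).
  apply/subsetP => y; rewrite !inE => /andP[yD ->] /=.
  by apply: contra yD => /eqP->; apply: imset_f.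
by apply/subsetP => y yC; rewrite !inE; apply: contraNneq xC => <-.
Qed.

End MinorClosed.

(** * Checking certificates *)

Definition xor_sum (I : Type) (F : I -> bool) (s : seq I) : bool :=
  foldr (fun i b => F i (+) b) false s.

Lemma xor_sumE (I : Type) (F : I -> bool) (s : seq I) :
  xor_sum F s = \big[addb/false]_(i <- s) F i.
Proof. by elim: s => [|i s IHs]; rewrite ?big_nil ?big_cons //= IHs. Qed.

Section Certificate.
(* A binary matrix [A] with rows [rows] and columns [cols]. A certificate is a
   list of sums of rows of [A], each given by its list of summands: the head is
   the row [w] and the tail consists of the rows of the incidence matrix. *)
Variables (I J : eqType) (A : I -> J -> bool) (rows : seq I) (cols : seq J).
Implicit Types (cert : seq (seq I)) (c : J) (s : seq J).

Definition cert_row cert (k : nat) c : bool :=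
  xor_sum (A^~ c) (nth [::] cert k).

Definition cert_ends cert c : seq nat :=
  [seq k <- iota 1 (size cert).-1 | cert_row cert k c].

Definition vec_add (u v : seq bool) : seq bool :=
  [seq b.1 (+) b.2 | b <- zip u v].

(* Gaussian elimination; the basis vector [v] with pivot [j] is the sum of the
   rows of the certificate listed in [m]. *)
Fixpoint reduce (basis : seq (nat * seq bool * seq nat)) (t : seq bool)
    (ks : seq nat) : seq bool * seq nat :=
  if basis is (j, v, m) :: basis' then
    if nth false t j then reduce basis' (vec_add t v) (m ++ ks)
    else reduce basis' t ks
  else (t, ks).

Definition cert_basis cert s : seq (nat * seq bool * seq nat) :=
  foldl (fun basis k =>
      let: (t, ks) := reduce basis [seq cert_row cert k c | c <- s] [:: k] in
      let j := index true t in
      if (j < size t)%N then rcons basis (j, t, ks) else basis)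
    [::] (iota 0 (size cert)).

(** The elimination only proposes the summands [ks]; their sum is then compared with [t] in every
    column, so no correctness proof of [reduce] is required. *)
Definition spanned cert s basis (t : J -> bool) : bool :=
  let ks := (reduce basis [seq t c | c <- s] [::]).2 in
  all (fun c => t c == xor_sum (cert_row cert ^~ c) ks) s.

Definition delete_cert cert x : bool :=
  let s := [seq c <- cols | c != x] in
  let basis := cert_basis cert s in
  [&& all (all [in rows]) cert,
      all (fun c => size (cert_ends cert c) \in [:: 0; 2]) s &
      all (fun r => spanned cert s basis (A r)) rows].

(** Cocycles of the contraction are the cocycles avoiding [x]. They are spanned by the rows of [A]
    once a row [r0] with a one at [x] has cleared that column; the tests say that the certificate
    spans the same space. *)
Definition contract_cert cert x : bool :=
  let s := [seq c <- cols | c != x] in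
  let basis := cert_basis cert s in
  [&& all (all [in rows]) cert,
      all (fun c => size (cert_ends cert c) \in [:: 0; 2]) s,
      all (fun k => ~~ cert_row cert k x) (iota 0 (size cert)) &
      has (fun r0 => A r0 x &&
        all (fun r => spanned cert s basis
          (fun c => A r c (+) (A r x && A r0 c))) rows) rows].

(** For an empty list both ends default to 0, which gives a loop; index 0 is the row [w] and never
    an end otherwise. *)
Lemma cert_endsP cert c v : size (cert_ends cert c) \in [:: 0; 2] ->
  (nth 0 (cert_ends cert c) 0 == v) (+) (nth 0 (cert_ends cert c) 1 == v) =
  (0 < v < size cert)%N && cert_row cert v c.
Proof.
have -> : (0 < v < size cert)%N && cert_row cert v c = (v \in cert_ends cert c).
  rewrite mem_filter mem_iota andbC; congr (_ && _).
  by case: (size cert) => [|n]; case: v.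
have := filter_uniq (fun k => cert_row cert k c) (iota_uniq 1 (size cert).-1).
rewrite -/(cert_ends cert c); case: (cert_ends cert c) => [|a [|b []]] //=.
  by rewrite addbb.
rewrite !inE andbT ![v == _]eq_sym => nab _.
by case: eqP => [<-|] //=; rewrite eq_sym (negbTE nab).
Qed.

Variables (E : finType) (idx : E -> J) (Z : {set {set E}}).
Hypotheses (idx_inj : injective idx) (idx_cols : forall e, idx e \in cols).
Hypothesis ZP : forall X, X \in Z <->
  {in rows, forall r, parity (fun e => A r (idx e)) X = false}.

Lemma cert_even_cycle_set cert x (X : {set E}) : X \subset ~: [set x] ->
  all (fun c => size (cert_ends cert c) \in [:: 0; 2])
    [seq c <- cols | c != idx x] ->
  even_cycle_set (fun e => cert_row cert 0 (idx e))
    (fun e => nth 0 (cert_ends cert (idx e)) 0)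
    (fun e => nth 0 (cert_ends cert (idx e)) 1) X <->
  forall k, parity (fun e => cert_row cert k (idx e)) X = false.
Proof.
move=> /subsetP Xx /allP deg.
have dE v : parity (fun e => (nth 0 (cert_ends cert (idx e)) 0 == v) (+)
    (nth 0 (cert_ends cert (idx e)) 1 == v)) X =
    (0 < v < size cert)%N && parity (fun e => cert_row cert v (idx e)) X.
  rewrite -parity_andb; apply: eq_parity => e eX; apply: cert_endsP; apply: deg.
  by have := Xx _ eX; rewrite !inE mem_filter idx_cols (inj_eq idx_inj) andbT.
split=> [[kw kv] k | kr]; last by split=> [|v]; rewrite ?dE kr ?andbF.
have [->//|k0] := posnP k.
have [kc|ck] := ltnP k (size cert); first by have := kv k; rewrite dE k0 kc.
by rewrite /parity big1 // => e _; rewrite /cert_row nth_default.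
Qed.

Lemma spanned_parity cert x basis t (X : {set E}) : X \subset ~: [set x] ->
  spanned cert [seq c <- cols | c != idx x] basis t ->
  (forall k, parity (fun e => cert_row cert k (idx e)) X = false) ->
  parity (fun e => t (idx e)) X = false.
Proof.
move=> /subsetP Xx /allP; set ks := _.2 => tE kr.
transitivity
  (parity (fun e => \big[addb/false]_(k <- ks) cert_row cert k (idx e)) X).
  apply: eq_parity => e eX; rewrite -xor_sumE; apply/eqP/tE.
  by have := Xx _ eX; rewrite !inE mem_filter idx_cols (inj_eq idx_inj) andbT.
by rewrite parity_sum big1 // => k _; apply: kr.
Qed.

Lemma parity_cert_row cert k (X : {set E}) :
  parity (fun e => cert_row cert k (idx e)) X =
  \big[addb/false]_(r <- nth [::] cert k) parity (fun e => A r (idx e)) X.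
Proof. by rewrite -parity_sum; apply: eq_parity => e _; rewrite -xor_sumE. Qed.

Lemma parity_cert_row_cycle cert k X : all (all [in rows]) cert -> X \in Z ->
  parity (fun e => cert_row cert k (idx e)) X = false.
Proof.
move=> /allP cr /ZP XZ; rewrite parity_cert_row big_seq big1 // => r rk.
apply: XZ; have [kc|ck] := ltnP k (size cert).
  by have /allP := cr _ (mem_nth [::] kc); apply.
by rewrite nth_default in rk.
Qed.

Lemma delete_certP cert x : delete_cert cert (idx x) ->
  even_cycle_minor Z (~: [set x]) set0.
Proof.
case/and3P => cr deg /allP sp.
exists (fun e => cert_row cert 0 (idx e)),
  (fun e => nth 0 (cert_ends cert (idx e)) 0),
  (fun e => nth 0 (cert_ends cert (idx e)) 1) => X Xx.
apply: iff_trans (iff_sym (cert_even_cycle_set Xx deg)).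
split=> [[Y] | kr].
  rewrite subset0 => /eqP->; rewrite symdiff0 => XZ k.
  exact: parity_cert_row_cycle.
exists set0; rewrite // symdiff0; apply/ZP => r rr.
exact: spanned_parity Xx (sp _ rr) kr.
Qed.

Lemma contract_certP cert x : contract_cert cert (idx x) ->
  even_cycle_minor Z (~: [set x]) [set x].
Proof.
case/and4P => cr deg /allP zx /hasP[r0 rr0 /andP[r0x /allP sp]].
exists (fun e => cert_row cert 0 (idx e)),
  (fun e => nth 0 (cert_ends cert (idx e)) 0),
  (fun e => nth 0 (cert_ends cert (idx e)) 1) => X Xx.
apply: iff_trans (iff_sym (cert_even_cycle_set Xx deg)).
split=> [[Y] | kr].
  rewrite subset1 => Yx XZ k; have := parity_cert_row_cycle k cr XZ.
  rewrite parity_symdiff.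
  case/orP: Yx => /eqP->; rewrite ?parity0 ?parity1 ?addbF //.
  have [kc|ck] := ltnP k (size cert).
    by rewrite (negbTE (zx k _)) ?mem_iota // addbF.
  by rewrite {2}/cert_row nth_default //= addbF.
have {}sp r : r \in rows -> parity (fun e => A r (idx e)) X =
    A r (idx x) && parity (fun e => A r0 (idx e)) X.
  move=> /sp /(spanned_parity Xx)/(_ kr).
  by rewrite parity_addb parity_andb => /negbT; rewrite negb_add => /eqP.
(* The pivot row decides whether [X] or [X] with [x] added is the cycle. *)
case pX: (parity (fun e => A r0 (idx e)) X).
  exists [set x]; rewrite ?subxx //; apply/ZP => r rr.
  by rewrite parity_symdiff parity1 sp // pX andbT addbb.
exists set0; rewrite ?sub0set // symdiff0; apply/ZP => r rr.
by rewrite sp // pX andbF.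
Qed.

End Certificate.

(** * The cogirth bound *)

(* If [m] vertices have nonzero rows in the incidence matrix then, these rows
   summing to zero, the matroid has rank at most [1 + (m - 1)]; on the other
   hand the rows contain at most two ones per column. *)
Lemma even_cycle_cogirth_bound (E : finType) (M : matroid E)
    (Z : {set {set E}}) (B : {set E}) (g : nat) :
  represents M Z -> is_even_cycle M -> B \in indep M -> (1 < #|B|)%N ->
  (forall Y, Y \in orth Z -> Y != set0 -> (g <= #|Y|)%N) ->
  (#|B| * g <= 2 * #|E|)%N.
Proof.
move=> MZ eM BM B1 gZ; have [_ MZi] := MZ.
have [w [p [q ZE]]] := (is_even_cycleP MZ).1 eM.
pose d v := [set e | (p e == v) (+) (q e == v)].
have dE v X : parity [in d v] X = parity (fun e => (p e == v) (+) (q e == v)) X.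
  by apply: eq_parity => e _; rewrite inE.
have dZ v : d v \in orth Z by apply/orthP => C /ZE[_ kv]; rewrite dE.
have [N' /all_and2[pN qN]] := ends_bound p q; set N := N'.+1 in pN qN.
pose V := [set v : 'I_N | d v != set0].
have sum_d : (\sum_(v < N) #|d v| <= 2 * #|E|)%N.
  under eq_bigr do rewrite -sum1_card big_mkcond /=.
  rewrite exchange_big mulnC -sum_nat_const; apply: leq_sum => e _.
  apply: (@leq_trans
    (\sum_(v < N) ((v == Ordinal (pN e)) + (v == Ordinal (qN e))))).
    apply: leq_sum => v _; rewrite inE -!val_eqE /= ![val v == _]eq_sym.
    by do 2!case: (_ == _).
  have one (a : 'I_N) : (\sum_(v < N) (v == a) = 1)%N.
    by rewrite (bigD1 a) //= eqxx big1 // => v /negbTE->.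
  by rewrite big_split /= !one.
have sum_V : (#|V| * g <= 2 * #|E|)%N.
  apply: leq_trans sum_d; rewrite -sum_nat_const big_mkcond.
  by apply: leq_sum => v _; rewrite inE; case: ifP => // dv; apply: gZ.
apply: leq_trans sum_V; rewrite leq_mul2r; apply/orP; right.
have sumd0 X : \big[addb/false]_(v < N) parity [in d v] X = false.
  rewrite -parity_sum /parity big1 // => e _.
  under eq_bigr do rewrite inE.
  have one (a : 'I_N) : \big[addb/false]_(v < N) (a == v :> nat) = true.
    rewrite (bigD1 a) //= eqxx big1 // => v va.
    by rewrite eq_sym; apply/negbTE.
  by rewrite big_split /= (one (Ordinal (pN e))) (one (Ordinal (qN e))).
have d0 (v : 'I_N) X : v \notin V -> parity [in d v] X = false.
  by rewrite inE negbK => /eqP->; rewrite parity_memC parity0.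
(* One vertex [v0] may be ignored, its row being the sum of the others; [None] ignores nothing. *)
have Zsub (v0 : option 'I_N) X : parity w X = false -> X \subset B ->
    (forall v, Some v != v0 -> v \in V -> parity [in d v] X = false) ->
    X = set0.
  move=> wX XB dX; apply: (MZi B).1 => //; apply/ZE; split=> // v; rewrite -dE.
  have [vN | Nv] := ltnP v N; last first.
    rewrite /parity big1 // => e _; rewrite inE.
    by rewrite !ltn_eqF // (leq_trans _ Nv).
  have {}dX u : Some u != v0 -> parity [in d u] X = false.
    by move=> uv0; have [/(dX _ uv0)|/d0->] := boolP (u \in V).
  have [vv0 | /dX //] := eqVneq (Some (Ordinal vN)) v0.
  have := sumd0 X; rewrite (bigD1 (Ordinal vN)) //= big1 ?addbF // => u uv.
  by apply: dX; rewrite -vv0.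
(* Counting in place of dimension: as [B] contains no nonempty cycle, its subsets are told apart by
   their parities at [w] and at the vertices in [V']. *)
have sep (v0 : option 'I_N) :
    (2 ^ #|B| <= 2 * 2 ^ #|[set v in V | Some v != v0]|)%N.
  pose V' := [set v in V | Some v != v0].
  pose F (X : {set E}) := (parity w X, [set v in V' | parity [in d v] X]).
  have FI : {in powerset B &, injective F}.
    move=> X Y; rewrite !inE => XB YB [wXY /setP dXY]; apply: symdiff_eq0.
    apply: (Zsub v0); rewrite ?symdiff_sub // ?parity_symdiff ?wXY ?addbb //.
    move=> v vv0 vV; have := dXY v; rewrite parity_symdiff !inE vv0.
    by move: vV; rewrite inE => -> /= ->; rewrite addbb.
  rewrite -!card_powerset -(card_in_imset FI) -card_bool -cardsT -cardsX.
  apply: subset_leq_card; apply/subsetP => _ /imsetP[X _ ->]; rewrite !inE /=.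
  by apply/subsetP => v; rewrite !inE => /andP[].
(* If all rows vanish, [w] alone separates the subsets of [B], against [1 < #|B|]; otherwise
   dropping one nonzero row gives [#|B| <= #|V|]. *)
have [V0|[v0 v0V]] := set_0Vmem V.
  have := sep None; rewrite V0 (_ : [set v in set0 | _] = set0) ?cards0.
    by rewrite -expnS leq_exp2l // leqNgt B1.
  by apply/setP => v; rewrite !inE.
have := sep (Some v0); rewrite -expnS leq_exp2l // (cardsD1 v0 V) v0V.
rewrite (_ : [set v in V | _] = V :\ v0) //.
by apply/setP => v; rewrite !inE andbC.
Qed.

(** * L11 *)

Fixpoint bit_strings (n : nat) : seq (seq bool) :=
  if n is n'.+1 then [seq b :: s | b <- [:: true; false], s <- bit_strings n']
  else [:: [::]].

Lemma mem_bit_strings n s : (s \in bit_strings n) = (size s == n).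
Proof.
elim: n s => [|n IHn] [|b s] //=.
  by rewrite cats0 mem_cat; apply/negbTE; rewrite negb_or; apply/andP; split;
    apply/mapP => -[].
rewrite eqSS -IHn cats0 mem_cat; apply/orP/idP.
  by case=> /mapP[t ts [_ ->]].
by case: b => sn; [left | right]; apply: map_f.
Qed.

Section OrdinalSets.
Variables (n : nat).
Implicit Types X : {set 'I_n}.

Definition set_bits X : seq bool := [seq e \in X | e <- enum 'I_n].

Lemma size_set_bits X : size (set_bits X) = n.
Proof. by rewrite size_map size_enum_ord. Qed.

Lemma nth_set_bits X (e : 'I_n) : nth false (set_bits X) e = (e \in X).
Proof. by rewrite (nth_map e) ?size_enum_ord // nth_ord_enum. Qed.

Lemma count_set_bits X : count id (set_bits X) = #|X|.
Proof. by rewrite count_map enumT cardE /enum_mem size_filter. Qed.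

Lemma parity_set_bits (f : nat -> bool) X :
  parity (fun e : 'I_n => f e) X =
  xor_sum (fun i => nth false (set_bits X) i && f i) (iota 0 n).
Proof.
rewrite parityE xor_sumE -[n in iota 0 n]subn0 -/(index_iota 0 n) big_mkord.
by apply: eq_bigr => e _; rewrite nth_set_bits.
Qed.

End OrdinalSets.

Lemma natr_F2 (k : nat) : (k%:R = (odd k)%:R :> 'F_2)%R.
Proof. by elim: k => // k IHk; rewrite mulrS IHk -(F2_addb true). Qed.

Definition L11_bit (i j : nat) : bool := odd (nth 0 (nth [::] L11_rows i) j).

Lemma L11_kernelP (X : {set 'I_11}) : X \in kernel L11_matrix <->
  {in iota 0 6, forall r, parity (fun e : 'I_11 => L11_bit r e) X = false}.
Proof.
have AE (i : 'I_6) (j : 'I_11) : (L11_matrix i j != 0)%R = L11_bit i j.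
  by rewrite mxE natr_F2 -/(L11_bit i j); case: (L11_bit i j).
split=> [/kernelP kX r | kX].
  rewrite mem_iota => lt6; rewrite -(kX (Ordinal lt6)).
  by apply: eq_parity => e _; rewrite AE.
apply/kernelP => i; rewrite -(kX i) ?mem_iota ?ltn_ord //.
by apply: eq_parity => e _; rewrite AE.
Qed.

(* The fundamental cycles with respect to the basis consisting of the first six
   columns. *)
Definition L11_cycles : seq (seq nat) :=
  [:: [:: 0; 1; 6]; [:: 2; 3; 4; 7]; [:: 0; 2; 3; 5; 8]; [:: 1; 2; 4; 5; 9];
      [:: 0; 1; 3; 4; 5; 10]].

(** Exhaustion over the 2^11 bit strings: orthogonality to the five fundamental cycles suffices to
    force four elements. *)
Lemma L11_cogirth (Y : {set 'I_11}) :
  Y \in orth (kernel L11_matrix) -> Y != set0 -> 4 <= #|Y|.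
Proof.
move=> /orthP oY Y0.
have cyc : all (fun C =>
    ~~ xor_sum [in C] [seq i <- iota 0 11 | nth false (set_bits Y) i])
    L11_cycles.
  apply/allP => C CL; pose X := [set e : 'I_11 | val e \in C].
  have XZ : X \in kernel L11_matrix.
    apply/L11_kernelP => r r6.
    have -> : parity (fun e : 'I_11 => L11_bit r e) X =
              xor_sum (fun i => (i \in C) && L11_bit r i) (iota 0 11).
      rewrite parity_set_bits !xor_sumE !big_seq; apply: eq_bigr => i.
      by rewrite mem_iota => i11; rewrite (nth_set_bits X (Ordinal i11)) inE.
    have : all (fun C => all (fun r =>
        ~~ xor_sum (fun i => (i \in C) && L11_bit r i) (iota 0 11)) (iota 0 6))
      L11_cycles by vm_compute.
    by move=> /allP/(_ _ CL)/allP/(_ _ r6)/negbTE.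
  suff -> : xor_sum [in C] [seq i <- iota 0 11 | nth false (set_bits Y) i] =
            parity [in X] Y by rewrite parity_memC oY.
  rewrite (@eq_parity _ _ (fun e => val e \in C)); last first.
    by move=> e _; rewrite inE.
  rewrite (parity_set_bits [in C]) !xor_sumE big_filter big_mkcond.
  by apply: eq_bigr => i _; case: (nth _ _ i).
have chk : all (fun s => (has id s && all (fun C =>
        ~~ xor_sum [in C] [seq i <- iota 0 11 | nth false s i]) L11_cycles)
    ==> (4 <= count id s)) (bit_strings 11) by vm_compute.
rewrite -count_set_bits; move: chk.
move=> /allP/(_ (set_bits Y)); rewrite mem_bit_strings size_set_bits cyc eqxx.
rewrite andbT => /(_ isT)/implyP; apply; have [e eY] := set0Pn _ Y0.
by apply/(has_nthP false); exists e; rewrite ?size_set_bits ?nth_set_bits.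
Qed.

Lemma L11_not_even_cycle : ~ is_even_cycle L11.
Proof.
move=> eL; pose B := [set e : 'I_11 | e < 6].
have cB : #|B| = 6.
  rewrite -count_set_bits -[RHS]/(count (fun i => i < 6) (iota 0 11)).
  rewrite count_map -val_enum_ord count_map.
  by apply: eq_count => e; rewrite /= inE.
have LZ : represents L11 (kernel L11_matrix) := represents_vector _.
have BI : B \in indep L11.
  (* The first six columns form an identity matrix, so row [e] meets [C] in [e] alone. *)
  apply/(proj2 LZ) => C /L11_kernelP CZ CB; apply/setP => e; rewrite inE.
  apply/negP => eC; have := subsetP CB _ eC; rewrite inE => e6.
  have := CZ e; rewrite mem_iota e6 => /(_ isT).
  rewrite /parity (bigD1 e) //= big1 => [|x /andP[xC xe]].
    rewrite addbF; case: e e6 {eC} => -[|[|[|[|[|[|]]]]]] //.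
  have := subsetP CB _ xC; rewrite inE => x6.
  have : all (fun i => all (fun j => (i != j) ==> ~~ L11_bit i j) (iota 0 6))
    (iota 0 6) by vm_compute.
  move=> /allP/(_ e); rewrite mem_iota e6 => /(_ isT)/allP/(_ x).
  by rewrite mem_iota x6 eq_sym val_eqE xe => /(_ isT)/negbTE.
have := even_cycle_cogirth_bound LZ eL BI; rewrite cB => /(_ 4 isT L11_cogirth).
by rewrite card_ord.
Qed.

(* The [i]-th certificate is for the [i]-th column. *)
Definition L11_delete_certs : seq (seq (seq nat)) :=
  [:: [:: [:: 4]; [:: 0]; [:: 0; 1]; [:: 0; 1; 2]; [:: 0; 3];
          [:: 2; 4; 5]; [:: 3; 4; 5]];
      [:: [:: 4]; [:: 1]; [:: 0; 1]; [:: 0; 1; 2]; [:: 1; 2; 3];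
          [:: 4; 5]; [:: 3; 4; 5]];
      [:: [:: 5]; [:: 2]; [:: 0; 1; 2]; [:: 2; 3]; [:: 1; 2; 3];
          [:: 2; 4]; [:: 0; 2; 4]];
      [:: [:: 5]; [:: 3]; [:: 0; 3]; [:: 2; 3]; [:: 1; 2; 3];
          [:: 3; 4]; [:: 0; 1; 3; 4]];
      [:: [:: 5]; [:: 4]; [:: 1; 4]; [:: 2; 4]; [:: 0; 2; 4];
          [:: 3; 4]; [:: 0; 1; 3; 4]];
      [:: [:: 3]; [:: 5]; [:: 0; 5]; [:: 1; 5]; [:: 2; 5];
          [:: 0; 1; 3; 4]; [:: 2; 3; 4]];
      [:: [:: 4]; [:: 0]; [:: 1]; [:: 0; 3]; [:: 1; 2; 3];
          [:: 4; 5]; [:: 2; 4; 5]];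
      [:: [:: 5]; [:: 2]; [:: 0; 1; 2]; [:: 3]; [:: 0; 3]; [:: 4]; [:: 1; 4]];
      [:: [:: 4]; [:: 0]; [:: 0; 1]; [:: 2]; [:: 3]; [:: 1; 5]; [:: 2; 3; 5]];
      [:: [:: 4]; [:: 1]; [:: 0; 1]; [:: 2]; [:: 2; 3]; [:: 0; 5]; [:: 3; 5]];
      [:: [:: 4]; [:: 0]; [:: 1]; [:: 3]; [:: 2; 3]; [:: 0; 1; 5]; [:: 2; 5]]].

(** Contraction lowers the rank to five, hence five vertices instead of six. *)
Definition L11_contract_certs : seq (seq (seq nat)) :=
  [:: [:: [:: 4]; [:: 1]; [:: 2]; [:: 1; 2; 3]; [:: 4; 5]; [:: 3; 4; 5]];
      [:: [:: 4]; [:: 0]; [:: 2]; [:: 0; 3]; [:: 2; 4; 5]; [:: 3; 4; 5]];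
      [:: [:: 3]; [:: 0]; [:: 1]; [:: 0; 1; 3; 4]; [:: 3; 5]; [:: 4; 5]];
      [:: [:: 4]; [:: 0]; [:: 1]; [:: 0; 1; 2]; [:: 4; 5]; [:: 2; 4; 5]];
      [:: [:: 3]; [:: 0]; [:: 1]; [:: 0; 1; 2]; [:: 3; 5]; [:: 2; 3; 5]];
      [:: [:: 3]; [:: 0]; [:: 1]; [:: 2]; [:: 0; 1; 3; 4]; [:: 2; 3; 4]];
      [:: [:: 3]; [:: 0; 1]; [:: 2]; [:: 0; 1; 3; 4]; [:: 2; 5]; [:: 3; 4; 5]];
      [:: [:: 5]; [:: 0]; [:: 1]; [:: 0; 1; 3; 4]; [:: 2; 3; 5]; [:: 2; 4; 5]];
      [:: [:: 4]; [:: 1]; [:: 0; 1; 2]; [:: 0; 3]; [:: 2; 4; 5]; [:: 3; 4; 5]];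
      [:: [:: 1; 4]; [:: 0]; [:: 0; 1; 2]; [:: 1; 2; 3];
          [:: 4; 5]; [:: 3; 4; 5]];
      [:: [:: 0; 4]; [:: 0; 1]; [:: 0; 3]; [:: 1; 2; 3];
          [:: 4; 5]; [:: 2; 4; 5]]].

Lemma L11_excluded_minor : excluded_minor is_even_cycle L11.
Proof.
split; first exact: L11_not_even_cycle.
have cols (e : 'I_11) : val e \in iota 0 11 by rewrite mem_iota ltn_ord.
apply: (proper_minors_even_cycle (represents_vector _)) => x.
  apply: (delete_certP val_inj cols L11_kernelP
    (cert := nth [::] L11_delete_certs x)).
  have : all (fun c => delete_cert L11_bit (iota 0 6) (iota 0 11)
    (nth [::] L11_delete_certs c) c) (iota 0 11) by vm_compute.
  by move=> /allP/(_ _ (cols x)).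
apply: (contract_certP val_inj cols L11_kernelP
  (cert := nth [::] L11_contract_certs x)).
have : all (fun c => contract_cert L11_bit (iota 0 6) (iota 0 11)
  (nth [::] L11_contract_certs c) c) (iota 0 11) by vm_compute.
by move=> /allP/(_ _ (cols x)).
Qed.

(** * PG(3,2) minus a point *)

Definition code (v : 'cV['F_2]_4) : seq bool :=
  [seq (v i 0 != 0)%R | i <- enum 'I_4].

Lemma size_code v : size (code v) = 4.
Proof. by rewrite size_map size_enum_ord. Qed.

Lemma nth_code v (i : 'I_4) : nth false (code v) i = (v i 0 != 0)%R.
Proof. by rewrite (nth_map i) ?size_enum_ord // nth_ord_enum. Qed.

Lemma code_inj : injective code.
Proof.
move=> u v uv; apply/matrixP => i j; rewrite ord1.
by rewrite [LHS]F2_cases [RHS]F2_cases -!nth_code uv.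
Qed.

Lemma code0 : code 0 = nseq 4 false.
Proof.
apply: (@eq_from_nth _ false); rewrite ?size_code ?size_nseq // => i i4.
by rewrite (nth_code 0 (Ordinal i4)) mxE eqxx nth_nseq i4.
Qed.

Lemma code_surj c : size c = 4 -> exists v, code v = c.
Proof.
move=> c4; exists (\col_i ((nth false c i)%:R : 'F_2))%R.
apply: (@eq_from_nth _ false); rewrite ?size_code ?c4 // => i i4.
rewrite (nth_code _ (Ordinal i4)) mxE.
by case: (nth _ _ _).
Qed.

Lemma nth_vec_add u v i : size u = size v ->
  nth false (vec_add u v) i = nth false u i (+) nth false v i.
Proof.
move=> uv; have [iu|ui] := ltnP i (size u).
  by rewrite (nth_map (false, false)) ?size_zip ?uv ?minnn -?uv // nth_zip.
by rewrite !nth_default // -?uv // size_map size_zip -uv minnn.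
Qed.

Section DeletedPG.
Variable e : PG32_point.

Let T : finType := {x : PG32_point | x \notin [set e]}.

Definition point_code (x : T) : seq bool := code (val (val x)).

Definition deleted_PG_cycles : {set {set T}} := [set X : {set T} |
  val @: X \in kernel (fun (i : 'I_4) (v : PG32_point) => val v i 0%R)].

Lemma represents_deleted_PG :
  represents (delete PG32 [set e]) deleted_PG_cycles.
Proof. exact: represents_delete (represents_vector _) _. Qed.

Lemma deleted_PG_cyclesP (X : {set T}) : X \in deleted_PG_cycles <->
  {in iota 0 4, forall r,
    parity (fun x => nth false (point_code x) r) X = false}.
Proof.
rewrite inE; split=> [/kernelP kX r | kX].
  rewrite mem_iota => r4; rewrite -[RHS](kX (Ordinal r4)).
  rewrite (parity_imset _ _ val_inj); apply: eq_parity => x _ /=.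
  by rewrite /point_code (nth_code _ (Ordinal r4)).
apply/kernelP => r; rewrite (parity_imset _ _ val_inj).
rewrite -[RHS](kX r) ?mem_iota ?ltn_ord //.
by apply: eq_parity => x _; rewrite /= /point_code nth_code.
Qed.

Lemma point_code_inj : injective point_code.
Proof. by move=> x y /code_inj/val_inj/val_inj. Qed.

Definition nonzero_codes : seq (seq bool) :=
  [seq c <- bit_strings 4 | c != nseq 4 false].

Lemma nonzero_code (x : PG32_point) : code (val x) \in nonzero_codes.
Proof.
rewrite mem_filter mem_bit_strings size_code eqxx andbT -code0.
rewrite (inj_eq code_inj); exact: valP x.
Qed.

Definition deleted_PG_codes (c : seq bool) : seq (seq bool) :=
  [seq c' <- nonzero_codes | c' != c].

Lemma point_codeP (x : T) : point_code x \in deleted_PG_codes (code (val e)).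
Proof.
rewrite mem_filter nonzero_code andbT (inj_eq code_inj) (inj_eq val_inj).
by have := valP x; rewrite inE.
Qed.

Lemma point_code_surj c : c \in deleted_PG_codes (code (val e)) ->
  exists x, point_code x = c.
Proof.
rewrite !mem_filter mem_bit_strings => /and3P[ce c0 /eqP c4].
have [v vc] := code_surj c4.
have v0 : (v != 0)%R by rewrite -(inj_eq code_inj) code0 vc.
have ve : Sub v v0 \notin [set e].
  by rewrite inE -(inj_eq val_inj) -(inj_eq code_inj) SubK vc.
by exists (Sub (Sub v v0) ve); rewrite /point_code !SubK.
Qed.

(* Some plane contains neither [e] nor the at most one element on which the
   incidence matrix vanishes. Its seven points have seven columns of weight two,
   fourteen ones in total, but every row has 0 or 4 ones on the plane. *)
Lemma deleted_PG_not_even_cycle : ~ is_even_cycle (delete PG32 [set e]).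
Proof.
move=> /(is_even_cycleP represents_deleted_PG)[w [p [q ZE]]].
pose d v x := (p x == v) (+) (q x == v).
(* The three points of a line form a cycle, so every row of the incidence matrix is a linear
   functional on the points. *)
have line x y z v : point_code z = vec_add (point_code x) (point_code y) ->
    d v z = d v x (+) d v y.
  move=> zxy.
  have : symdiff (symdiff [set x] [set y]) [set z] \in deleted_PG_cycles.
    apply/deleted_PG_cyclesP => r _; rewrite !parity_symdiff !parity1 zxy.
    by rewrite nth_vec_add ?addbb // !size_code.
  move=> /ZE[_ /(_ v)]; rewrite !parity_symdiff !parity1 -/(d v x) -/(d v y).
  by rewrite -/(d v z); do 3!case: (d v _).
(* A graph loop outside [w] would be a matroid loop and two loops in [w] would be parallel; points
   being nonzero and distinct, at most one element has equal ends. If there is none, [[::]] is the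
   code of no point. *)
have [c0 c0P] : exists c0, forall x, point_code x != c0 -> p x != q x.
  have [/existsP[y /eqP pqy] | /existsPn no] := boolP [exists y, p y == q y];
    last by exists [::].
  have wy x : p x = q x -> w x.
    move=> pqx; apply: contraT => wx.
    have /deleted_PG_cyclesP xZ : [set x] \in deleted_PG_cycles.
      by apply/ZE; split=> [|v]; rewrite parity1 ?(negbTE wx) ?pqx ?addbb.
    have := nonzero_code (val x); rewrite mem_filter => /andP[/negP[]].
    apply/eqP/(@eq_from_nth _ false); rewrite ?size_code ?size_nseq // => i i4.
    by have := xZ i; rewrite mem_iota i4 parity1 => ->; rewrite // nth_nseq i4.
  exists (point_code y) => x; apply: contraNneq => pqx.
  have /deleted_PG_cyclesP xZ : symdiff [set x] [set y] \in deleted_PG_cycles.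
    apply/ZE; split=> [|v]; rewrite parity_symdiff !parity1 ?wy //.
    by rewrite pqx pqy !addbb.
  apply/eqP/(@eq_from_nth _ false); rewrite ?size_code // => i i4.
  have := xZ i; rewrite mem_iota i4 parity_symdiff !parity1 => /(_ isT).
  by do 2!case: (nth _ _ _).
pose plane (a b c : seq bool) := let ab := vec_add a b in
  [:: a; b; c; ab; vec_add a c; vec_add b c; vec_add ab c].
(* The vectors e_j + f_j e_i, with i the first index such that f_i = 1, form a basis of the plane f
   = 0. *)
pose basis (f : seq bool) := let i := index true f in
  [seq mkseq (fun k => (k == j) (+) (nth false f j && (k == i))) 4
    | j <- iota 0 4 & j != i].
pose avoids ce c0 := all [in [seq c' <- deleted_PG_codes ce | c' != c0]].
pose good ce c0 := has (fun f =>
  if basis f is [:: a; b; c] then avoids ce c0 (plane a b c) else false)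
  nonzero_codes.
have ex_plane : good (code (val e)) c0.
  have [c0s|c0s] := boolP (c0 \in bit_strings 4).
    have : all (fun ce => all (good ce) (bit_strings 4)) nonzero_codes.
      by vm_compute.
    by move=> /allP/(_ _ (nonzero_code e))/allP/(_ _ c0s).
  (* A string [c0] of the wrong length excludes no point; neither does the zero string, which
     replaces it. *)
  have : all (fun ce => good ce (nseq 4 false)) nonzero_codes by vm_compute.
  move=> /allP/(_ _ (nonzero_code e)); congr is_true.
  rewrite /good; apply: eq_has => g; case: (basis g) => [|a [|b [|c []]]] //.
  apply: eq_all => c'; rewrite /= !mem_filter !mem_bit_strings.
  have [->|] := eqVneq c' (nseq 4 false); first by rewrite !andbF.
  rewrite /= => _; have [cc|//] := eqVneq c' c0.
  by move: c0s; rewrite -cc mem_bit_strings => /negbTE->; rewrite !andbF.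
have [a [b [c /allP pl]]] :
    exists a b c, avoids (code (val e)) c0 (plane a b c).
  have [g _] := hasP ex_plane; case: (basis g) => [|a [|b [|c []]]] // pl.
  by exists a, b, c.
have pick c' : c' \in plane a b c -> exists x, point_code x = c' /\ p x != q x.
  move=> /pl; rewrite /= mem_filter => /andP[c'0 /point_code_surj[x xc]].
  by exists x; split=> //; apply: c0P; rewrite xc.
have [|x1 [c1 n1]] := pick a; first by rewrite !inE eqxx.
have [|x2 [c2 n2]] := pick b; first by rewrite !inE eqxx !orbT.
have [|x3 [c3 n3]] := pick c; first by rewrite !inE eqxx !orbT.
have [|x4 [c4 n4]] := pick (vec_add a b); first by rewrite !inE eqxx !orbT.
have [|x5 [c5 n5]] := pick (vec_add a c); first by rewrite !inE eqxx !orbT.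
have [|x6 [c6 n6]] := pick (vec_add b c); first by rewrite !inE eqxx !orbT.
have [|x7 [c7 n7]] := pick (vec_add (vec_add a b) c).
  by rewrite !inE eqxx !orbT.
have [N' /all_and2[pN qN]] := ends_bound p q; set N := N'.+1 in pN qN.
have deg x : p x != q x -> \sum_(v < N) d v x = 2.
  move=> nx; rewrite (bigD1 (Ordinal (pN x))) //= (bigD1 (Ordinal (qN x))) /=.
    rewrite /d !eqxx eq_sym (negbTE nx) /= big1 // => v /andP[vp vq].
    rewrite ![_ == val v]eq_sym.
    by rewrite (negbTE (vp : val v != p x)) (negbTE (vq : val v != q x)).
  by rewrite -val_eqE /= eq_sym.
have : 4 %| \sum_(v < N)
    (d v x1 + d v x2 + d v x3 + d v x4 + d v x5 + d v x6 + d v x7).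
  apply: dvdn_sum => v _.
  rewrite (@line x4 x3 x7) ?c4 ?c3 // (@line x1 x2 x4) ?c1 ?c2 //.
  rewrite (@line x1 x3 x5) ?c1 ?c3 // (@line x2 x3 x6) ?c2 ?c3 //.
  by case: (d v x1); case: (d v x2); case: (d v x3).
by rewrite !big_split /= !deg.
Qed.

Definition PG_functional (l : seq nat) (c : seq bool) : bool :=
  xor_sum (nth false c) l.

Definition PG_functionals : seq (seq nat) :=
  [seq [seq r <- iota 0 4 | nth false c r] | c <- bit_strings 4].

(* The vertices are the functionals equal to 1 on both deleted points. *)
Definition PG_delete_cert (c c' : seq bool) : seq (seq nat) :=
  head [::]
    [seq l <- PG_functionals | PG_functional l c (+) PG_functional l c'] ::
  [seq l <- PG_functionals | PG_functional l c && PG_functional l c'].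

(* The functionals vanishing on the contracted point have dimension three; the
   vertices are the nonzero functionals of a two-dimensional subspace. *)
Definition PG_contract_cert (c : seq bool) : seq (seq nat) :=
  let i := index true c in
  let f j := if nth false c j then [:: j; i] else [:: j] in
  if [seq f j | j <- iota 0 4 & j != i] is [:: l1; l2; l3] then
    [:: l1; l2; l3; l2 ++ l3] else [::].

(** Four functionals equal 1 on two given points. At a third point two of them equal 1, or none if
    it is the sum of the two; that point becomes a loop, made odd by [w]. After a contraction, the
    points where [l2] and [l3] vanish are loops, odd because [l1] is 1 there. *)
Lemma deleted_PG_excluded_minor :
  excluded_minor is_even_cycle (delete PG32 [set e]).
Proof.
split; first exact: deleted_PG_not_even_cycle.
have chk : all (fun c => all (fun c' =>
    delete_cert (fun r => nth false ^~ r) (iota 0 4) (deleted_PG_codes c)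
      (PG_delete_cert c c') c' &&
    contract_cert (fun r => nth false ^~ r) (iota 0 4) (deleted_PG_codes c)
      (PG_contract_cert c') c') (deleted_PG_codes c)) nonzero_codes.
  by vm_compute.
apply: (proper_minors_even_cycle represents_deleted_PG) => x.
all: have /allP/(_ _ (point_codeP x)) := allP chk _ (nonzero_code e).
all: case/andP => del con.
  exact: (delete_certP point_code_inj point_codeP deleted_PG_cyclesP del).
exact: (contract_certP point_code_inj point_codeP deleted_PG_cyclesP con).
Qed.

End DeletedPG.

(** * L19 *)

Definition L19_edges : seq (nat * nat) :=
  [seq c <- [seq (i, j) | i <- iota 0 7, j <- iota 0 7] |
    (c.1 < c.2) && (c \notin [:: (0, 1); (0, 2)])].

Lemma mem_L19_edges c : (c \in L19_edges) =
  [&& c.1 < c.2, c \notin [:: (0, 1); (0, 2)] & c.2 < 7].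
Proof.
case: c => i j; rewrite mem_filter -andbA.
have -> : ((i, j) \in [seq (i, j) | i <- iota 0 7, j <- iota 0 7]) =
          (i < 7) && (j < 7).
  apply/allpairsPdep/andP => [[i' [j' [+ + [-> ->]]]] | [i7 j7]].
    by rewrite !mem_iota.
  by exists i, j; rewrite !mem_iota.
case: ltnP => //= ij; congr (_ && _).
by apply: andb_idl; apply: ltn_trans.
Qed.

(* The triangle formed by the edge [r] and the vertex 6; it is zero if 6 is an
   end of [r]. *)
Definition L19_bit (r c : nat * nat) : bool :=
  (c == r) (+) (c == (r.1, 6)) (+) ((r.2 != 6) && (c == (r.2, 6))).

Section LabelledL19.
Variables (T : finType) (idx : T -> nat * nat) (Z0 : {set {set T}}).
Hypotheses (idx_inj : injective idx) (idx_mem : forall x, idx x \in L19_edges).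
Hypothesis idx_surj : forall c, c \in L19_edges -> exists x, idx x = c.
Hypothesis lZ0 : linear_space Z0.
Hypothesis Z0P : forall X, X \in Z0 <->
  forall v, parity (fun x => ((idx x).1 == v) (+) ((idx x).2 == v)) X = false.

Lemma perm_idx : perm_eq [seq idx x | x <- enum T] L19_edges.
Proof.
apply: uniq_perm => [||c]; [by rewrite map_inj_uniq ?enum_uniq | by [] |].
apply/mapP/idP => [[x _ ->] // | /idx_surj[x <-]].
by exists x; rewrite // mem_enum.
Qed.

Lemma parity_idx (f g : nat * nat -> bool) :
  parity (fun x => f (idx x)) [set x | g (idx x)] =
  xor_sum (fun c => g c && f c) L19_edges.
Proof.
rewrite xor_sumE -(perm_big _ perm_idx) big_map big_enum parityE /=.
by apply: eq_bigr => x _; rewrite inE.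
Qed.

Lemma card_idx (g : nat * nat -> bool) :
  #|[set x | g (idx x)]| = count g L19_edges.
Proof.
rewrite -(permP perm_idx) count_map enumT cardE /enum_mem size_filter.
by apply: eq_count => x; rewrite /= inE.
Qed.

Definition spoke (X : {set T}) (i : nat) : bool :=
  (i != 6) && parity (fun x => idx x == (i, 6)) X.

Lemma parity_L19_bit (X : {set T}) (x : T) :
  parity (fun y => L19_bit (idx x) (idx y)) X =
  (x \in X) (+) spoke X (idx x).1 (+) spoke X (idx x).2.
Proof.
rewrite /L19_bit !parity_addb parity_andb -/(spoke X (idx x).2).
congr (_ (+) _ (+) _); last first.
  rewrite /spoke; have := idx_mem x; rewrite mem_L19_edges => /and3P[h _ h7].
  by rewrite ltn_eqF // (leq_trans h).
rewrite -[RHS]/([in X] x) -[RHS]parity1 parity_memC.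
by apply: eq_parity => y _; rewrite inE (inj_eq idx_inj).
Qed.

(** Vertex 6 is adjacent to all others, so the spokes form a spanning tree whose fundamental cycles
    are the triangles at 6. A set orthogonal to them contains an edge iff exactly one of its ends
    has its spoke in the set; thus it is a sum of vertex stars. *)
Lemma L19_cyclesP (X : {set T}) : X \in orth Z0 <->
  {in L19_edges, forall r, parity (fun x => L19_bit r (idx x)) X = false}.
Proof.
split=> [/orthP oX r rE | kX].
  pose Y := [set x | L19_bit r (idx x)].
  rewrite (@eq_parity _ _ [in Y]) => [|x _]; last by rewrite inE.
  rewrite parity_memC oX //; apply/Z0P => v.
  rewrite (parity_idx (fun c => (c.1 == v) (+) (c.2 == v)) (L19_bit r)).
  have [v7|v7] := ltnP v 7.
    have : all (fun r => all (fun v => ~~ xor_sum (fun c =>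
        L19_bit r c && ((c.1 == v) (+) (c.2 == v))) L19_edges) (iota 0 7))
      L19_edges.
      by vm_compute.
    by move=> /allP/(_ _ rE)/allP/(_ v); rewrite mem_iota => /(_ v7)/negbTE.
  rewrite xor_sumE big_seq big1 // => c.
  rewrite mem_L19_edges => /and3P[h _ h7]; have h' := leq_trans h7 v7.
  by rewrite !ltn_eqF ?andbF // (ltn_trans h).
apply/orthP => C /Z0P CZ.
have XE x : x \in C -> (x \in X) = \big[addb/false]_(v <- iota 0 7)
    (spoke X v && (((idx x).1 == v) (+) ((idx x).2 == v))).
  move=> _; have := parity_L19_bit X x; rewrite kX // => /esym/negbT.
  rewrite -addbA negb_add => /eqP->.
  have one i : i < 7 ->
      \big[addb/false]_(v <- iota 0 7) (spoke X v && (i == v)) = spoke X i.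
    move=> i7; rewrite (bigD1_seq i) ?iota_uniq ?mem_iota //= eqxx andbT.
    by rewrite big1 ?addbF // => v /negbTE; rewrite eq_sym => ->; rewrite andbF.
  have := idx_mem x; rewrite mem_L19_edges => /and3P[h _ h7].
  under eq_bigr do rewrite andb_addr.
  by rewrite big_split /= !one // (ltn_trans h).
rewrite (eq_parity XE) parity_sum big1 // => v _.
by rewrite parity_andb CZ andbF.
Qed.

(** Cocycles of the dual are cycles of the graph, which has neither loops nor parallel edges. *)
Lemma L19_cogirth (Y : {set T}) :
  Y \in orth (orth Z0) -> Y != set0 -> 3 <= #|Y|.
Proof.
rewrite orthK // => YZ Y0.
have nx x : (idx x).1 != (idx x).2.
  by have := idx_mem x; rewrite mem_L19_edges => /andP[h _]; rewrite ltn_eqF.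
have nY1 x : Y != [set x].
  apply: contraTneq YZ => ->; apply/negP => /Z0P/(_ (idx x).1).
  by rewrite parity1 eqxx eq_sym (negbTE (nx x)).
have nY2 x y : x != y -> Y != [set x; y].
  move=> xy; apply: contraTneq YZ => ->; apply/negP => /Z0P.
  have -> : [set x; y] = symdiff [set x] [set y].
    apply/setP => z; rewrite in_symdiff !inE.
    by case: eqP => [->|] //; rewrite (negbTE xy).
  move=> k; move: xy; rewrite -(inj_eq idx_inj).
  have {}k v : ((idx x).1 == v) (+) ((idx x).2 == v) =
               ((idx y).1 == v) (+) ((idx y).2 == v).
    have := k v; rewrite parity_symdiff !parity1 => /negbT.
    by rewrite negb_add => /eqP.
  move: k; have := idx_mem x; have := idx_mem y; rewrite !mem_L19_edges.
  case: (idx x) (idx y) => [i j] [i' j'] /andP[/= ij' _] /andP[/= ij _] k.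
  have := k i; have := k j; rewrite !eqxx (ltn_eqF ij) (gtn_eqF ij) xpair_eqE.
  have [ei|ni] := eqVneq i' i; have [ej|nj] := eqVneq j' j.
  - by [].
  - by rewrite ei (ltn_eqF ij).
  - by rewrite ej (gtn_eqF ij).
  case: (eqVneq i' j) => // e1; case: (eqVneq j' i) => // e2 _ _.
  by move: ij'; rewrite e1 e2 ltnNge ltnW.
rewrite ltnNge; apply/negP.
case cY: #|Y| => [|[|[|]]] // _.
- by move/eqP: cY; rewrite cards_eq0 (negbTE Y0).
- by have /eqP/cards1P[x eY] := cY; have := nY1 x; rewrite eY eqxx.
by have /eqP/cards2P[x [y [xy eY]]] := cY; have := nY2 _ _ xy; rewrite eY eqxx.
Qed.

(** The edges avoiding 6 are the complement of the spanning star, hence independent in the dual. *)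
Lemma L19_labelled_not_even_cycle (M : matroid T) :
  represents M (orth Z0) -> ~ is_even_cycle M.
Proof.
move=> MZ eM; pose B := [set x | (idx x).2 != 6].
have BI : B \in indep M.
  apply/(proj2 MZ) => C /L19_cyclesP CZ CB.
  have sp i : spoke C i = false.
    rewrite /spoke /parity big1 ?andbF // => x /(subsetP CB).
    rewrite inE; case: (idx x) => j k /= k6.
    by rewrite xpair_eqE (negbTE k6) andbF.
  by apply/setP => x; have := parity_L19_bit C x; rewrite CZ // !sp !addbF inE.
have cB : #|B| = 13 by rewrite (card_idx (fun c => c.2 != 6)).
have cT : #|T| = 19.
  by rewrite -cardsT -[setT]/[set x | predT (idx x)] card_idx.
have := even_cycle_cogirth_bound MZ eM BI; rewrite cB cT.
by move=> /(_ 3 isT L19_cogirth).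
Qed.

(** Each edge stands for its triangle with 6. Along a closed walk the extra spokes cancel in pairs,
    so the sum of these rows is the walk itself. *)
Definition walk_edges (s : seq nat) : seq (nat * nat) :=
  [seq (minn c.1 c.2, maxn c.1 c.2) | c <- zip s (rot 1 s)].

(* Row [w] and the rows of the incidence matrix are cycles of the graph, so that
   the vertices correspond to the faces of a drawing on a (possibly pinched)
   surface. Before deleting an element from the matroid, the cycles may use the
   corresponding edge. *)
Definition L19_delete_walks : seq ((nat * nat) * seq (seq nat)) :=
  [:: ((1, 2),
       [:: [:: 0; 3; 6]; [:: 0; 3; 4]; [:: 0; 3; 5]; [:: 0; 4; 6];
           [:: 0; 5; 6]; [:: 1; 2; 3]; [:: 1; 2; 6; 3]; [:: 1; 2; 4];
           [:: 1; 2; 6; 4]; [:: 1; 2; 5]; [:: 1; 2; 4; 5]; [:: 3; 4; 5];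
           [:: 1; 2; 5; 6]; [:: 1; 2; 3; 6]]);
      ((0, 3),
       [:: [:: 0; 4; 6]; [:: 1; 2; 6]; [:: 1; 2; 5]; [:: 0; 3; 1; 5];
           [:: 1; 3; 4]; [:: 1; 4; 6]; [:: 0; 3; 4]; [:: 2; 4; 5];
           [:: 0; 3; 2; 4]; [:: 2; 3; 6]; [:: 4; 5; 6]; [:: 0; 3; 5];
           [:: 0; 3; 6]; [:: 0; 3; 5; 6]]);
      ((1, 3),
       [:: [:: 0; 3; 6]; [:: 0; 3; 4]; [:: 0; 4; 6]; [:: 0; 3; 1; 5];
           [:: 0; 5; 6]; [:: 1; 2; 3]; [:: 1; 2; 6]; [:: 1; 3; 4];
           [:: 2; 4; 5]; [:: 2; 4; 6]; [:: 1; 4; 5]; [:: 1; 3; 6];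
           [:: 2; 3; 5]; [:: 3; 5; 6]]);
      ((3, 4),
       [:: [:: 0; 4; 6]; [:: 0; 3; 4]; [:: 0; 3; 4; 5]; [:: 0; 5; 6];
           [:: 0; 4; 3; 6]; [:: 1; 3; 4]; [:: 1; 3; 4; 5]; [:: 1; 2; 5];
           [:: 1; 4; 6]; [:: 1; 2; 6]; [:: 2; 3; 4]; [:: 2; 3; 5];
           [:: 2; 4; 3; 6]; [:: 3; 4; 6; 5]])].

(** Contraction in the dual deletes the edge from the graph, so these walks avoid it. *)
Definition L19_contract_walks : seq ((nat * nat) * seq (seq nat)) :=
  [:: ((1, 2),
       [:: [:: 0; 3; 6]; [:: 0; 3; 4]; [:: 0; 3; 5]; [:: 0; 4; 6];
           [:: 0; 5; 6]; [:: 1; 3; 4]; [:: 1; 3; 6]; [:: 1; 4; 5];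
           [:: 1; 5; 6]; [:: 2; 3; 5]; [:: 2; 3; 6]; [:: 2; 4; 5];
           [:: 2; 4; 6]]);
      ((0, 3),
       [:: [:: 1; 3; 6]; [:: 0; 4; 6]; [:: 0; 4; 5]; [:: 0; 5; 6];
           [:: 1; 2; 6]; [:: 1; 2; 5]; [:: 1; 3; 4]; [:: 1; 3; 5];
           [:: 1; 4; 6]; [:: 2; 4; 5]; [:: 2; 3; 4]; [:: 2; 3; 6];
           [:: 3; 5; 6]]);
      ((1, 3),
       [:: [:: 1; 5; 6]; [:: 0; 3; 4]; [:: 0; 3; 5]; [:: 0; 4; 6];
           [:: 0; 5; 6]; [:: 1; 2; 6]; [:: 1; 2; 5]; [:: 1; 4; 5];
           [:: 1; 4; 6]; [:: 2; 4; 5]; [:: 2; 3; 4]; [:: 2; 3; 6];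
           [:: 3; 5; 6]]);
      ((3, 4),
       [:: [:: 0; 5; 6]; [:: 0; 3; 5]; [:: 0; 3; 6]; [:: 0; 4; 6];
           [:: 0; 4; 5]; [:: 1; 2; 3]; [:: 1; 3; 5]; [:: 2; 3; 6];
           [:: 1; 2; 4]; [:: 1; 4; 6]; [:: 1; 5; 6]; [:: 2; 4; 5];
           [:: 2; 5; 6]])].

Lemma L19_labelled_minors (x : T) :
  idx x \in [:: (1, 2); (0, 3); (1, 3); (3, 4)] ->
  even_cycle_minor (orth Z0) (~: [set x]) set0 /\
  even_cycle_minor (orth Z0) (~: [set x]) [set x].
Proof.
move=> xs.
have chk : all (fun cw => delete_cert L19_bit L19_edges L19_edges
      [seq walk_edges s | s <- cw.2] cw.1) L19_delete_walks &&
    all (fun cw => contract_cert L19_bit L19_edges L19_edges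
      [seq walk_edges s | s <- cw.2] cw.1) L19_contract_walks by vm_compute.
have {chk}[/allP del /allP con] := andP chk.
split.
  have /mapP[cw cwD xE] : idx x \in [seq cw.1 | cw <- L19_delete_walks] by [].
  apply: (delete_certP idx_inj idx_mem L19_cyclesP); rewrite xE; exact: del cwD.
have /mapP[cw cwD xE] : idx x \in [seq cw.1 | cw <- L19_contract_walks] by [].
apply: (contract_certP idx_inj idx_mem L19_cyclesP); rewrite xE; exact: con cwD.
Qed.

End LabelledL19.

(** [undup] keeps last occurrences, hence the two reversals. Vertex [a] is labelled 0, then come [b]
    and [c], then the ends of [st] not yet placed; [c] precedes [b] if it alone is an end of [st].
    The kinds of [st] are: [bc], at [a], at one of [b] and [c], or disjoint from all three. *)
Definition L19_order (a b c s t : nat) : seq nat :=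
  let bc := if (c \in [:: s; t]) && (b \notin [:: s; t]) then [:: c; b]
            else [:: b; c] in
  rev (undup (rev (a :: bc ++ [:: s; t] ++ iota 0 7))).

(* Up to symmetry there are four kinds of edges besides [ab] and [ac]. *)
Lemma L19_orderP (a b c s t : nat) :
  all (fun v => v < 7) [:: a; b; c; s; t] -> uniq [:: a; b; c] -> s != t ->
  (s, t) \notin [:: (a, b); (b, a); (a, c); (c, a)] ->
  let o := L19_order a b c s t in
  let i := index s o in let j := index t o in
  [/\ perm_eq o (iota 0 7), index a o = 0,
      (index b o, index c o) \in [:: (1, 2); (2, 1)]
    & (minn i j, maxn i j) \in [:: (1, 2); (0, 3); (1, 3); (3, 4)]].
Proof.
move=> /and5P[a7 b7 c7 s7 /andP[t7 _]] uabc st nst.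
have : all (fun a => all (fun b => all (fun c => all (fun s => all (fun t =>
  [&& uniq [:: a; b; c], s != t
    & (s, t) \notin [:: (a, b); (b, a); (a, c); (c, a)]] ==>
  let o := L19_order a b c s t in
  let i := index s o in let j := index t o in
  [&& perm_eq o (iota 0 7), index a o == 0,
      (index b o, index c o) \in [:: (1, 2); (2, 1)]
    & (minn i j, maxn i j) \in [:: (1, 2); (0, 3); (1, 3); (3, 4)]])
  (iota 0 7)) (iota 0 7)) (iota 0 7)) (iota 0 7)) (iota 0 7) by vm_compute.
move=> /allP/(_ a); rewrite mem_iota => /(_ a7)/allP/(_ b).
rewrite mem_iota => /(_ b7)/allP/(_ c); rewrite mem_iota => /(_ c7)/allP/(_ s).
rewrite mem_iota => /(_ s7)/allP/(_ t); rewrite mem_iota => /(_ t7).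
rewrite uabc st nst /= => /and4P[? /eqP ? ? ?]; by split.
Qed.

(** * L19 for a given pair of adjacent edges *)

Section ConcreteL19.
Variables (a b c : 'I_7) (e f : {S : {set 'I_7} | #|S| == 2}).
Hypotheses (uabc : uniq [:: a; b; c]).
Hypotheses (eE : val e = [set a; b]) (fE : val f = [set a; c]).

Let T : finType := {x : {S : {set 'I_7} | #|S| == 2} | x \notin [set e; f]}.
Let H := graph_delete (complete_graph 7) [set e; f].

Lemma represents_L19 : represents (L19 e f) (orth (kernel (incidence H))).
Proof.
apply: represents_dual; have := represents_vector (incidence H).
by congr represents; apply: matroid_eq; rewrite /= forestsE.
Qed.

(** Instead of applying automorphisms of the graph, each edge [st] gets a labelling of its own,
    induced by [L19_order]; the certificates speak of labels only. *)
Lemma L19_labelling (s t : 'I_7) : s != t ->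
  [set s; t] != [set a; b] -> [set s; t] != [set a; c] ->
  exists idx : T -> nat * nat,
  [/\ injective idx,
      forall x, idx x \in L19_edges,
      forall d, d \in L19_edges -> exists x, idx x = d,
      forall X, X \in kernel (incidence H) <-> forall v,
        parity (fun x => ((idx x).1 == v) (+) ((idx x).2 == v)) X = false
    & forall x, val (val x) = [set s; t] ->
        idx x \in [:: (1, 2); (0, 3); (1, 3); (3, 4)]].
Proof.
move=> st nab nac.
have [||||perm_o a0 bc12 st4] := @L19_orderP a b c s t; rewrite //= ?ltn_ord //.
  rewrite !inE !xpair_eqE; apply/negP; move: nab nac => /eqP nab /eqP nac.
  case/or4P=> /andP[/eqP/val_inj es /eqP/val_inj et].
  - by apply: nab; rewrite es et.
  - by apply: nab; rewrite es et setUC.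
  - by apply: nac; rewrite es et.
  - by apply: nac; rewrite es et setUC.
set o := L19_order a b c s t in perm_o a0 bc12 st4.
pose lab (v : 'I_7) := index (val v) o.
have o_mem (v : 'I_7) : val v \in o.
  by rewrite (perm_mem perm_o) mem_iota ltn_ord.
have o7 : size o = 7 by rewrite (perm_size perm_o).
have lab7 v : lab v < 7 by rewrite -o7 index_mem.
have lab_inj : injective lab.
  move=> u v uv; apply: val_inj; rewrite -(nth_index 0 (o_mem u)) -/(lab u) uv.
  by rewrite nth_index.
have lab_surj i : i < 7 -> exists v, lab v = i.
  move=> i7; have io : nth 0 o i \in o by rewrite mem_nth ?o7.
  have := io; rewrite (perm_mem perm_o) mem_iota => v7.
  exists (Ordinal v7); rewrite /lab /= index_uniq ?o7 //.
  by rewrite (perm_uniq perm_o) iota_uniq.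
have lab_bc : (lab b, lab c) \in [:: (1, 2); (2, 1)] by [].
have lab_a : lab a = 0 by [].
have /fin_all_exists[p /fin_all_exists[q pq]] : forall x : T, exists u v,
    val (val x) = [set u; v] /\ lab u < lab v.
  move=> x; have /cards2P[u [v [uv ->]]] := valP (val x).
  have := uv; rewrite -(inj_eq lab_inj) neq_ltn => /orP[luv|lvu].
    by exists u, v.
  by exists v, u; rewrite setUC.
have pq_uniq u v u' v' : [set u; v] = [set u'; v'] -> lab u < lab v ->
    lab u' < lab v' -> u = u' /\ v = v'.
  move=> E luv luv'.
  have : u \in [set u'; v'] by rewrite -E !inE eqxx.
  have : v \in [set u'; v'] by rewrite -E !inE eqxx orbT.
  rewrite !inE => /orP[] /eqP ev /orP[] /eqP eu //; move: luv; rewrite ev eu.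
  - by rewrite ltnn.
  - by rewrite ltnNge ltnW.
  by rewrite ltnn.
have lab12 u v : (lab u, lab v) \in [:: (0, 1); (0, 2)] ->
    [set u; v] = val e \/ [set u; v] = val f.
  rewrite eE fE !inE !xpair_eqE => uv.
  have /eqP ua : lab u == lab a by rewrite lab_a; case/orP: uv => /andP[].
  rewrite (lab_inj _ _ ua); have {uv} : (lab v == 1) || (lab v == 2).
    by case/orP: uv => /andP[_ ->]; rewrite ?orbT.
  have := lab_bc; rewrite !inE !xpair_eqE.
  case/orP => /andP[/eqP lb /eqP lc] /orP[] /eqP lv.
  - by left; rewrite (lab_inj v b) ?lv.
  - by right; rewrite (lab_inj v c) ?lv.
  - by right; rewrite (lab_inj v c) ?lv.
  - by left; rewrite (lab_inj v b) ?lv.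
have [lab_ab lab_ac] : lab a < lab b /\ lab a < lab c.
  by move: lab_bc; rewrite !inE !xpair_eqE lab_a => /orP[] /andP[/eqP-> /eqP->].
have [ab12 ac12] : (lab a, lab b) \in [:: (0, 1); (0, 2)] /\
                   (lab a, lab c) \in [:: (0, 1); (0, 2)].
  move: lab_bc; rewrite !inE !xpair_eqE lab_a.
  by case/orP => /andP[-> ->]; rewrite ?orbT.
pose idx x := (lab (p x), lab (q x)).
have idx_mem x : idx x \in L19_edges.
  have [E lpq] := pq x; rewrite mem_L19_edges lpq lab7 andbT /=.
  apply/negP => /lab12; rewrite -E => -[] /val_inj xe;
    by have := valP x; rewrite !inE xe eqxx ?orbT.
have idx_eq x u v : val (val x) = [set u; v] -> lab u < lab v ->
    idx x = (lab u, lab v).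
  move=> xE luv; have [E lpq] := pq x.
  by rewrite xE in E; have [-> ->] := pq_uniq _ _ _ _ E luv lpq.
exists idx; split=> //.
- move=> x y [/lab_inj pxy /lab_inj qxy]; apply: val_inj; apply: val_inj.
  by rewrite (pq x).1 (pq y).1 pxy qxy.
- case=> i j; rewrite mem_L19_edges /= => /and3P[ij nij j7].
  have [u ui] := lab_surj i (ltn_trans ij j7); have [v vj] := lab_surj j j7.
  have luv : lab u < lab v by rewrite ui vj.
  have c2 : #|[set u; v]| == 2.
    by rewrite cards2 -(inj_eq lab_inj) (ltn_eqF luv).
  have nab' : (lab u, lab v) \notin [:: (0, 1); (0, 2)] by rewrite ui vj.
  have xP : Sub [set u; v] c2 \notin [set e; f].
    apply: contra nab' => /set2P[] /(congr1 val) /=; rewrite ?eE ?fE => E.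
      by have [-> ->] := pq_uniq _ _ _ _ E luv lab_ab.
    by have [-> ->] := pq_uniq _ _ _ _ E luv lab_ac.
  by exists (Sub (Sub [set u; v] c2) xP); rewrite (@idx_eq _ u v) // ui vj.
- have inc (x : T) v := @incidence_pair _ _ H p q x v (pq x).1.
  move=> X; split=> [/kernelP kX v | kX].
    have [v7 | v7] := ltnP v 7; last first.
      rewrite /parity big1 // => x _.
      by rewrite !ltn_eqF // (leq_trans (lab7 _)).
    have [u <-] := lab_surj v v7; rewrite -[RHS](kX u).
    by apply: eq_parity => x _; rewrite inc /= !(inj_eq lab_inj).
  apply/kernelP => u; rewrite -[RHS](kX (lab u)).
  by apply: eq_parity => x _; rewrite inc /= !(inj_eq lab_inj).
move=> x xE.
suff -> : idx x = (minn (lab s) (lab t), maxn (lab s) (lab t)) by [].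
have := st; rewrite -(inj_eq lab_inj) neq_ltn => /orP[lst|lts].
  rewrite (idx_eq _ _ _ xE lst).
  by rewrite (minn_idPl (ltnW lst)) (maxn_idPr (ltnW lst)).
have {}xE := etrans xE (setUC _ _).
rewrite (idx_eq _ _ _ xE lts).
by rewrite (minn_idPr (ltnW lts)) (maxn_idPl (ltnW lts)).
Qed.

Lemma L19_abc_excluded_minor : excluded_minor is_even_cycle (L19 e f).
Proof.
have lZ : linear_space (kernel (incidence H)).
  by case: (represents_vector (incidence H)).
have [ab ac bc] : [/\ a != b, a != c & b != c].
  by have := uabc; rewrite /= !inE negb_or andbT => /andP[/andP[]].
split.
  (* Any labelling serves for this half; [bc] is an edge that was not deleted. *)
  have nab : [set b; c] != [set a; b].
    apply: contra ac => /eqP/setP/(_ a); rewrite !inE eqxx /=.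
    by rewrite (negbTE ab) /= => ->.
  have nac : [set b; c] != [set a; c].
    apply: contra ab => /eqP/setP/(_ a); rewrite !inE eqxx /=.
    by rewrite (negbTE ac) orbF => ->.
  have [idx [idx_inj idx_mem idx_surj idxP _]] := L19_labelling bc nab nac.
  exact: (L19_labelled_not_even_cycle idx_inj idx_mem idx_surj lZ idxP
    represents_L19).
have minors (x : T) :
    even_cycle_minor (orth (kernel (incidence H))) (~: [set x]) set0 /\
    even_cycle_minor (orth (kernel (incidence H))) (~: [set x]) [set x].
  have /cards2P[s [t [st xE]]] := valP (val x).
  have nx : (val x != e) && (val x != f).
    by have := valP x; rewrite !inE negb_or.
  have [nab nac] : [set s; t] != [set a; b] /\ [set s; t] != [set a; c].
    by rewrite -xE -eE -fE; apply/andP.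
  have [idx [idx_inj idx_mem idx_surj idxP idx4]] := L19_labelling st nab nac.
  exact: (L19_labelled_minors idx_inj idx_mem idx_surj idxP (idx4 x xE)).
by apply: (proper_minors_even_cycle represents_L19) => x; case: (minors x).
Qed.

End ConcreteL19.

Lemma L19_excluded_minor (e f : {S : {set 'I_7} | #|S| == 2}) :
  adjacent_edges (complete_graph 7) e f ->
  excluded_minor is_even_cycle (L19 e f).
Proof.
case/andP => ef; rewrite -setI_eq0 => /set0Pn[a /setIP[ae af]].
have other (g : {S : {set 'I_7} | #|S| == 2}) : a \in val g ->
    exists2 b, a != b & val g = [set a; b].
  have /cards2P[u [v [uv ->]]] := valP g; rewrite !inE => /orP[] /eqP->.
    by exists v.
  by exists u; rewrite 1?eq_sym // setUC.
have [b ab eE] := other e ae; have [c ac fE] := other f af.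
apply: (L19_abc_excluded_minor (a := a) (b := b) (c := c)) => //.
rewrite /= !inE negb_or ab ac /= andbT; apply: contra ef => /eqP bc.
by apply/eqP; apply: val_inj; rewrite /= eE fE bc.
Qed.

Theorem theorem4p1 :
  [/\ forall e : PG32_point, excluded_minor is_even_cycle (delete PG32 [set e]),
      forall e f : {S : {set 'I_7} | #|S| == 2},
        adjacent_edges (complete_graph 7) e f ->
        excluded_minor is_even_cycle (L19 e f)
    & excluded_minor is_even_cycle L11].
Proof.
split; first exact: deleted_PG_excluded_minor.
  exact: L19_excluded_minor.
exact: L11_excluded_minor.
Qed.
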